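(* Let $\Delta$ be a $d$-dimensional flag complex. Then there exists a balanced complex $\Gamma$ with the same $f$-vector as $\Delta$ such that $\beta_d(\Gamma) \geq \beta_d(\Delta)$.
   Context: A simplicial complex is a finite non-empty collection of finite subsets of a countable ground set, closed under taking subsets (it always contains the empty face). A flag complex is a simplicial complex in which every set of vertices that are pairwise joined by edges is a face (equivalently, the clique complex of its underlying graph). The $f$-vector of a $(d-1)$-dimensional complex $\Delta$ is $(f_{-1}(\Delta), f_0(\Delta), \dots, f_{d-1}(\Delta))$, where $f_i(\Delta)$ is the number of $i$-dimensional faces ($f_{-1}=1$). A simplicial complex $\Gamma$ of dimension $m-1$ is balanced if its ground set admits an ordered partition $(U_1,\dots,U_m)$ into $m$ parts such that every face $F$ satisfies $|F\cap U_i|\le 1$ for all $i$ (i.e. its vertices can be colored with $m$ colors so that every face has vertices of distinct colors). Fix a field $\Bbbk$; $\beta_k(\Delta)=\dim_{\Bbbk}\widetilde{H}_k(\Delta;\Bbbk)$ denotes the $k$-th reduced Betti number. *)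

(* Defs.v *)
From HB Require Import structures.
From mathcomp Require Import all_boot all_order all_algebra.
From mathcomp Require Import finmap.
From mathcomp Require Import zify.

Set Implicit Arguments.
Unset Strict Implicit.
Unset Printing Implicit Defensive.

Import Order.TTheory GRing.Theory Num.Theory.

Local Open Scope fset_scope.
Local Open Scope ring_scope.

Record simplicial_complex (T : countType) := SimplicialComplex {
  faces :> {fset {fset T}};
  faces_neq0 : faces != fset0;
  faces_closed : forall F G : {fset T}, G `<=` F -> F \in faces -> G \in faces
}.

Definition complex_dim (T : countType) (D : simplicial_complex T) : int :=
  (\max_(F <- faces D) #|` F|)%:Z - 1.

Definition faces_of_dim (T : countType) (D : simplicial_complex T) (i : int) :
    {fset {fset T}} :=
  [fset F in faces D | #|` F|%:Z - 1 == i].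

Definition fnum (T : countType) (D : simplicial_complex T) (i : int) : nat :=
  #|` faces_of_dim D i|.

(* The entry of index j is f_{j-1}, and the last one is f_{complex_dim D}. *)
Definition fvector (T : countType) (D : simplicial_complex T) : seq nat :=
  mkseq (fun j : nat => fnum D (j%:Z - 1)) (absz (complex_dim D + 2)).

Definition flag (T : countType) (D : simplicial_complex T) : Prop :=
  forall S : {fset T},
    (forall v, v \in S -> [fset v] \in faces D) ->
    (forall v w, v \in S -> w \in S -> v != w -> [fset v; w] \in faces D) ->
    S \in faces D.

(* The parts are automatically nonempty, because some face has m vertices. *)
Definition balanced (T : countType) (D : simplicial_complex T) : Prop :=
  exists m : nat, complex_dim D = m%:Z - 1 /\
  exists U : 'I_m -> {pred T},
    (forall x : T, exists! i : 'I_m, x \in U i) /\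
    (forall F : {fset T}, F \in faces D ->
       forall i : 'I_m, (#|` [fset x in F | x \in U i]| <= 1)%N).

Section Homology.

Variables (K : fieldType) (T : countType).

(* Faces are oriented by the total order that choice.pickle induces on T
   (finmap shadows the name pickle); the exponent is the position of v in F. *)
Definition face_sign (F : {fset T}) (v : T) : K :=
  (-1) ^+ #|` [fset w in F | (choice.pickle w < choice.pickle v)%N]|.

(* The coefficient of G in \sum_(v in F) face_sign F v *: (F `\ v). *)
Definition boundary_coef (F G : {fset T}) : K :=
  \sum_(v <- F | F `\ v == G) face_sign F v.

(* Chains are row vectors, so boundary maps act by right multiplication. The
   complex is the augmented one, since fset0 is a face of dimension -1. The
   target dimension j is always taken to be i - 1; it is a separate argument
   only so that consecutive boundary maps compose without casts. *)
Definition boundary (D : simplicial_complex T) (i j : int) :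
    'M[K]_(#|{: faces_of_dim D i}|, #|{: faces_of_dim D j}|) :=
  \matrix_(a, b) boundary_coef (val (enum_val a)) (val (enum_val b)).

Definition cycles (D : simplicial_complex T) (i : int) :=
  kermx (boundary D i (i - 1)).

Definition boundaries (D : simplicial_complex T) (i : int) :=
  boundary D (i + 1) i.

Lemma face_signD1 (F : {fset T}) (v w : T) : v \in F ->
  face_sign (F `\ v) w =
    if (choice.pickle v < choice.pickle w)%N then - face_sign F w
    else face_sign F w.
Proof.
move=> vF; rewrite /face_sign; case: ifP => lt.
  rewrite (cardfsD1 v [fset w0 in F | (choice.pickle w0 < choice.pickle w)%N]).
  rewrite !inE /= vF lt exprS mulN1r opprK.
  congr (_ ^+ #|` _|); apply/fsetP => x; rewrite !inE /=; by rewrite andbA.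
congr (_ ^+ #|` _|); apply/fsetP => x; rewrite !inE /=.
by case: eqP => [->|_] //=; rewrite lt andbF.
Qed.

Lemma boundary_boundary (D : simplicial_complex T) (i : int) :
  boundaries D i *m boundary D i (i - 1) = 0.
Proof.
apply/matrixP => a c; rewrite !mxE.
under eq_bigr do rewrite !mxE.
move: (val (enum_val c)) => G.
have := valP (enum_val a); move: (val (enum_val a)) => F.
rewrite !inE /= => /andP[FD /eqP cF].
transitivity (\sum_(H : faces_of_dim D i)
    boundary_coef F (val H) * boundary_coef (val H) G).
  rewrite [RHS](reindex (enum_val (A := {: faces_of_dim D i}))) //=.
  exact/onW_bij/enum_val_bij.
have -> : \sum_(H : faces_of_dim D i)
      boundary_coef F (val H) * boundary_coef (val H) G
    = \sum_(v <- F) face_sign F v * boundary_coef (F `\ v) G.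
  under eq_bigr do rewrite /boundary_coef big_distrl /= big_mkcond /=.
  rewrite exchange_big /= !big_seq; apply: eq_bigr => v vF.
  have FvP : F `\ v \in faces_of_dim D i.
    rewrite !inE /= (faces_closed (fsubD1set _ _) FD) /=.
    move: cF; rewrite (cardfsD1 v F) vF /= => cF.
    by apply/eqP; lia.
  rewrite (bigD1 [` FvP]) //= eqxx [X in _ + X]big1 ?addr0 // => H nH.
  case: eqP => // e; case/eqP: nH; exact: val_inj.
pose f v w := face_sign F v * face_sign F w *+ ((F `\ v) `\ w == G).
transitivity (\sum_(v <- F) \sum_(w <- F | w != v)
    (if (choice.pickle v < choice.pickle w)%N then - f v w else f v w)).
  rewrite !big_seq; apply: eq_bigr => v vF.
  rewrite /boundary_coef big_distrr /= big_mkcond /=.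
  rewrite [RHS]big_mkcond [RHS](big_fsetD1 v vF) /= eqxx add0r.
  rewrite !big_seq; apply: eq_bigr => w; rewrite !inE => /andP[wv wF].
  rewrite wv face_signD1 // /f.
  case: (_ == G); case: ifP => _; rewrite ?mulrN ?mulr1n ?mulr0n ?oppr0 //.
under eq_bigr => v _.
  rewrite (bigID (fun w => (choice.pickle v < choice.pickle w)%N)) /=.
  over.
rewrite big_split /= addrC.
have fC v w : f v w = f w v.
  rewrite /f mulrC; congr (_ *+ (_ == _)).
  by apply/fsetP => x; rewrite !inE andbCA.
have pI v w : choice.pickle v = choice.pickle w -> v = w :> T.
  exact: (pcan_inj choice.pickleK).
under eq_bigr do rewrite big_mkcond.
rewrite exchange_big /= -big_split big1 //= => v _.
rewrite [X in _ + X]big_mkcond -big_split big1 //= => w _.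
case: (eqVneq v w) => //= [_|vw]; first by rewrite addr0.
have : choice.pickle v != choice.pickle w by apply: contra_neq vw => /pI.
rewrite neq_ltn fC; case/orP => lt.
  by rewrite lt ltnNge (ltnW lt) /= subrr.
by rewrite lt /= ltnNge (ltnW lt) /= addr0.
Qed.

Lemma boundaries_sub_cycles (D : simplicial_complex T) (i : int) :
  (boundaries D i <= cycles D i)%MS.
Proof. by apply/sub_kermxP; exact: boundary_boundary. Qed.

(* The dimension of the quotient of the cycles by the boundaries. *)
Definition betti (D : simplicial_complex T) (i : int) : nat :=
  (\rank (cycles D i) - \rank (boundaries D i))%N.

End Homology.

(* Main.v *)
(* Order the partial transversals of a family of linearly ordered colour classes
   colexicographically, comparing vertices first by level and then by colour. Among
   all families of k.+1-sets of a given size the initial segment has the smallest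
   shadow (the coloured Kruskal-Katona theorem of Frankl, Furedi and Kalai); when
   every colour is used it also has the fewest cells meeting the bottom level, among
   families closed under replacing a vertex by the lowest one of its colour. Both
   follow by compressing in one colour and by induction on the number of colours; a
   family fixed by all compressions is improved by exchanging its last cell with its
   first missing one, since these two agree in no colour.

   In a flag complex choose, for fixed k, a vertex v0 in as many faces of size k.+1 as
   possible and delete one by one the vertices not adjacent to v0. What is removed at
   each step is counted by a link, which is flag of smaller dimension and has at most
   as many faces of size k as the link of v0; what remains is a cone over that link.
   So by induction the initial segment with as many sets of size k.+1 as the complex
   has faces of that size has a shadow no larger than the number of faces of size k,
   and the initial segments form a balanced complex. For the top dimension the same
   deletions give a set of faces on which a top cycle cannot vanish, of size at most
   the number of cells of the initial segment avoiding the bottom level; each such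
   cell is the leading term of a cross-polytope cycle of the balanced complex. *)

Require Import Defs.
From HB Require Import structures.
From mathcomp Require Import all_boot all_order all_algebra.
From mathcomp Require Import finmap.
From mathcomp Require Import zify.

Set Implicit Arguments.
Unset Strict Implicit.
Unset Printing Implicit Defensive.

Import GRing.Theory.

(** * Colexicographic order on coloured sets *)

Section Colex.

Variables M N : nat.

(* x e = 0 when the set x has no vertex of colour e, and x e is the level of that
   vertex otherwise. *)
Local Notation pt := {ffun 'I_M -> 'I_N.+1}.

Implicit Types (x y z u : pt) (e f c : 'I_M) (S : {set 'I_M}) (A B I U : {set pt}).

Definition upd x e (j : 'I_N.+1) : pt := [ffun i => if i == e then j else x i].

Definition supp x : {set 'I_M} := [set e | 0 < x e].

(** Since [e < M], comparing positions compares levels first and lets colours break ties. *)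
Definition pos e (j : nat) : nat := j * M + e.

Definition bit e (j : nat) : nat := (0 < j) * 2 ^ pos e j.

(* The binary number of the set of positions, so that wt orders sets colexicographically. *)
Definition wt x : nat := \sum_e bit e (x e).

Lemma updE x e j f : upd x e j f = if f == e then j else x f.
Proof. by rewrite ffunE. Qed.

Lemma upd_eq x e j : upd x e j e = j.
Proof. by rewrite updE eqxx. Qed.

Lemma upd_neq x e j f : f != e -> upd x e j f = x f.
Proof. by rewrite updE => /negPf ->. Qed.

Lemma upd_upd x e j i : upd (upd x e j) e i = upd x e i.
Proof. by apply/ffunP => f; rewrite !updE; case: eqP. Qed.

Lemma updC x e f i j : e != f -> upd (upd x e i) f j = upd (upd x f j) e i.
Proof.
move=> ef; apply/ffunP => g; rewrite !updE.
by case: (eqVneq g f) => // ->; rewrite eq_sym (negPf ef).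
Qed.

Lemma upd_id x e : upd x e (x e) = x.
Proof. by apply/ffunP => f; rewrite updE; case: eqP => // ->. Qed.

Lemma upd_same x e j : x e = j -> upd x e j = x.
Proof. by move=> <-; apply: upd_id. Qed.

Lemma wtD1 x e : wt x = bit e (x e) + \sum_(f | f != e) bit f (x f).
Proof. by rewrite /wt (bigD1 e). Qed.

Lemma wt_upd x e j : wt (upd x e j) + bit e (x e) = wt x + bit e j.
Proof.
rewrite !(wtD1 _ e) upd_eq.
under eq_bigr => f fe do rewrite upd_neq //.
lia.
Qed.

Lemma pos_lt e f i j : i < j -> pos e i < pos f j.
Proof. by rewrite /pos; have := ltn_ord e; nia. Qed.

Lemma pos_inj e f i j : pos e i = pos f j -> e = f /\ i = j.
Proof.
move=> h; suff ij : i = j.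
  by split=> //; apply/val_inj => /=; move: h; rewrite /pos ij; lia.
by case: (ltngtP i j) => // ij;
  [have := pos_lt e f ij | have := pos_lt f e ij]; lia.
Qed.

Lemma pos_lt_level e f i j : pos e i < pos f j -> i <= j.
Proof. by move=> h; rewrite leqNgt; apply/negP => /(pos_lt f e); rewrite ltnNge ltnW. Qed.

Lemma leq_posE e i j : (pos e i <= pos e j) = (i <= j).
Proof.
case: (leqP i j) => [ij|/(pos_lt e e)]; last by rewrite ltnNge => /negbTE.
by rewrite /pos leq_add2r leq_mul2r ij orbT.
Qed.

Lemma pos_lt_color e f i : (pos e i < pos f i) = (e < f).
Proof. by rewrite /pos ltn_add2l. Qed.

Lemma bit_pos e j : 0 < j -> bit e j = 2 ^ pos e j.
Proof. by rewrite /bit => ->; rewrite mul1n. Qed.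

Lemma bit0 e : bit e 0 = 0.
Proof. by []. Qed.

Lemma ltn_bit e f i j : 0 < j -> pos e i < pos f j -> bit e i < bit f j.
Proof.
move=> j0 h; rewrite (bit_pos f j0) /bit; case: (0 < i).
  by rewrite mul1n ltn_exp2l.
by rewrite mul0n expn_gt0.
Qed.

Lemma ltn_bit_level e i j : i < j -> bit e i < bit e j.
Proof. by move=> ij; apply: ltn_bit; [lia | apply: pos_lt]. Qed.

Lemma leq_bit_wt x e : bit e (x e) <= wt x.
Proof. by rewrite (wtD1 x e) leq_addr. Qed.

Lemma wt_upd_lt x e (j : 'I_N.+1) : j < x e -> wt (upd x e j) < wt x.
Proof. by move=> /(ltn_bit_level e); have := wt_upd x e j; lia. Qed.

Lemma wt_upd_gt x e (j : 'I_N.+1) : x e < j -> wt x < wt (upd x e j).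
Proof. by move=> /(ltn_bit_level e); have := wt_upd x e j; lia. Qed.

Lemma sum_pow2_lt n : \sum_(i < n) 2 ^ i < 2 ^ n.
Proof.
elim: n => [|n IH]; first by rewrite big_ord0.
by rewrite big_ord_recr /= expnS mul2n -addnn ltn_add2r.
Qed.

(** The vertices counted have distinct positions below [T], so the sum is at most that of all
    [2 ^ i] with [i < T]. *)
Lemma sum_bit_lt (P : pred 'I_M) x T :
  (forall f, P f -> 0 < x f -> pos f (x f) < T) ->
  \sum_(f | P f) bit f (x f) < 2 ^ T.
Proof.
move=> h; apply: leq_ltn_trans (sum_pow2_lt T).
rewrite (bigID (fun f => 0 < x f)) /= [X in _ + X]big1 ?addn0; last first.
  by move=> f /andP[_]; rewrite -eqn0Ngt => /eqP ->.
case: T h => [|T] h.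
  by rewrite big1 // => f /andP[Pf xf]; have := h f Pf xf.
rewrite (eq_bigr (fun f => 2 ^ (inord (pos f (x f)) : 'I_T.+1))); last first.
  by move=> f /andP[Pf xf]; rewrite bit_pos // inordK // h.
rewrite -(big_imset (fun i : 'I_T.+1 => 2 ^ i)) /=; last first.
  move=> f g /andP[Pf xf] /andP[Pg xg] /(congr1 val) /=.
  by rewrite !inordK ?h // => /pos_inj[].
by rewrite big_mkcond /=; apply: leq_sum => i _; case: ifP.
Qed.

(** Colours on which [x] and [y] agree cancel, and the remaining bits of [x] all lie below the
    single bit of [y] at [e]. *)
Lemma colex_lt x y e : x e < y e ->
  (forall f, f != e -> x f != y f -> 0 < x f -> pos f (x f) < pos e (y e)) ->
  wt x < wt y.
Proof.
move=> xye h; rewrite /wt (bigID (fun f => x f == y f)) /=.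
rewrite [X in _ < X](bigID (fun f => x f == y f)) /=.
rewrite (eq_bigr (fun f => bit f (y f))) => [|f /eqP -> //].
rewrite ltn_add2l [X in _ < X](bigD1 e (P := fun f => x f != y f)) /=; last first.
  by apply: contraTneq xye => ->; rewrite ltnn.
apply: leq_trans (leq_addr _ _); rewrite bit_pos; last lia.
apply: sum_bit_lt => f; case: (eqVneq f e) => [-> _ _|fe xy x0].
  exact: pos_lt.
exact: h.
Qed.

(** [e] is the colour of the highest vertex in which [x] and [y] differ; distinct colours have
    distinct positions, so this maximum is strict. *)
Lemma colex_max x y : x != y -> exists2 e, x e != y e &
  forall f, f != e -> x f != y f ->
    pos f (x f) < pos e (maxn (x e) (y e)) /\
    pos f (y f) < pos e (maxn (x e) (y e)).
Proof.
move=> xy; have [e0 e0P] : exists e, x e != y e.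
  apply/existsP; rewrite -negb_forall; apply: contra xy => /forallP h.
  by apply/eqP/ffunP => e; apply/eqP.
case: (@arg_maxnP _ e0 (fun e => x e != y e)
  (fun e => pos e (maxn (x e) (y e))) e0P) => e eP emax.
exists e => // f fe /emax /=; rewrite leq_eqVlt => /orP[/eqP/pos_inj[fe']|lt].
  by rewrite fe' eqxx in fe.
by split; apply: leq_ltn_trans lt; rewrite leq_posE; rewrite ?leq_maxl ?leq_maxr.
Qed.

Lemma colex_total x y : x != y ->
  (exists2 e, x e < y e & forall f, f != e -> x f != y f ->
     pos f (x f) < pos e (y e) /\ pos f (y f) < pos e (y e)) \/
  (exists2 e, y e < x e & forall f, f != e -> y f != x f ->
     pos f (y f) < pos e (x e) /\ pos f (x f) < pos e (x e)).
Proof.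
move=> /colex_max[e xye h].
case: (ltngtP (x e) (y e)) h => [xe|ye|/val_inj xe] h; last by rewrite xe eqxx in xye.
  by left; exists e.
by right; exists e => // f fe; rewrite eq_sym => /(h f fe)[].
Qed.

Lemma wt_inj : injective wt.
Proof.
move=> x y xy; apply/eqP/negPn/negP => /colex_total[] [e lt h].
  have : wt x < wt y by apply: (colex_lt lt) => f fe xyf _; case: (h f fe xyf).
  by rewrite xy ltnn.
have : wt y < wt x by apply: (colex_lt lt) => f fe xyf _; case: (h f fe xyf).
by rewrite xy ltnn.
Qed.

Lemma colexP x y : wt x < wt y -> exists2 e, x e < y e &
  forall f, f != e -> x f != y f ->
    pos f (x f) < pos e (y e) /\ pos f (y f) < pos e (y e).
Proof.
move=> xy; have /colex_total[//|[e lt h]] : x != y by apply: contraTneq xy => ->; rewrite ltnn.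
have : wt y < wt x by apply: (colex_lt lt) => f fe xyf _; case: (h f fe xyf).
by lia.
Qed.

Definition initial U I := I \subset U /\
  forall x y, x \in I -> y \in U -> wt y < wt x -> y \in I.

(** Membership is decided by the number of smaller elements of [U]; for [n] above [#|U|] the result
    is all of [U]. *)
Definition seg U n : {set pt} := [set x in U | #|[set y in U | wt y < wt x]| < n].

Lemma seg_sub U n : seg U n \subset U.
Proof. by apply/subsetP => x; rewrite inE => /andP[]. Qed.

Lemma seg_initial U n : initial U (seg U n).
Proof.
split=> [|x y]; first exact: seg_sub.
rewrite !inE => /andP[xU lt] -> yx /=; apply: leq_ltn_trans lt.
by apply: subset_leq_card; apply/subsetP => z; rewrite !inE => /andP[-> /=]; lia.
Qed.

Lemma initial_seg U I : initial U I -> I = seg U #|I|.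
Proof.
move=> [IU hI]; apply/setP => x; rewrite inE; apply/idP/andP => [xI|[xU lt]].
  split; first exact: (subsetP IU).
  rewrite [X in _ < X](cardsD1 x) xI add1n ltnS; apply: subset_leq_card.
  apply/subsetP => y; rewrite !inE => /andP[yU yx].
  by rewrite (hI x y) // andbT; apply: contraTneq yx => ->; rewrite ltnn.
apply: contraTT lt => xI; rewrite -leqNgt; apply: subset_leq_card.
apply/subsetP => y yI; rewrite inE (subsetP IU) //= ltnNge leq_eqVlt negb_or.
apply/andP; split.
  by apply: contraNN xI => /eqP/wt_inj ->.
by apply: contraNN xI => lt; apply: hI yI _ _.
Qed.

(** Adding the least missing element keeps an initial set initial, so there is one of each size, and
    [initial_seg] identifies it with the segment. *)
Lemma card_seg U n : n <= #|U| -> #|seg U n| = n.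
Proof.
suff h : n <= #|U| -> exists2 I, initial U I & #|I| = n.
  by move=> /h[I hI <-]; rewrite -(initial_seg hI).
elim: n => [|n IH] le.
  by exists set0; rewrite ?cards0 //; split=> [|x y]; rewrite ?sub0set ?inE.
have [I [IU hI] In] := IH (ltnW le).
have [x0 x0P] : exists x, x \in U :\: I.
  apply/set0Pn; rewrite -card_gt0 cardsD subn_gt0.
  by apply: leq_ltn_trans le; rewrite -In subset_leq_card ?subsetIr.
case: (@arg_minnP _ x0 (fun x => x \in U :\: I) wt x0P) => x; rewrite inE => /andP[xI xU] xmin.
exists (x |: I); last by rewrite cardsU1 xI In.
split; first by rewrite subUset sub1set xU.
move=> z y; rewrite !inE => /orP[/eqP ->|zI] yU lt.
  case: (boolP (y \in I)) => [|yI]; first by rewrite orbT.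
  by have := xmin y; rewrite inE yI yU => /(_ isT); lia.
by rewrite (hI z y) ?orbT.
Qed.

Lemma seg_subset U m n : m <= n -> seg U m \subset seg U n.
Proof.
by move=> mn; apply/subsetP => x; rewrite !inE => /andP[-> /=]; lia.
Qed.

(** Every element of [I] outside [A] precedes the least element of [A] outside [I], and both
    differences have the same size. Total weight thus measures progress towards a segment. *)
Lemma initial_sum_wt U I A : initial U I -> A \subset U -> #|A| = #|I| -> A != I ->
  \sum_(x in I) wt x < \sum_(x in A) wt x.
Proof.
move=> [IU hI] AU AI neq.
have cD : #|A :\: I| = #|I :\: A|.
  by have := cardsID I A; have := cardsID A I; rewrite setIC; lia.
have [z0 z0P] : exists z, z \in A :\: I.
  apply/set0Pn; apply: contra neq; rewrite setD_eq0 => sub.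
  by rewrite eqEcard sub AI /=.
case: (@arg_minnP _ z0 (fun z => z \in A :\: I) wt z0P) => z; rewrite inE => /andP[zI zA] zmin.
rewrite (big_setID A) /= [X in _ < X](big_setID I) /= setIC ltn_add2l.
have lt x : x \in I :\: A -> wt x < wt z.
  rewrite inE => /andP[xA xI]; rewrite ltnNge leq_eqVlt negb_or.
  apply/andP; split; first by apply: contraNneq zI => /wt_inj ->.
  by apply: contraNN zI => lt; apply: hI xI _ lt; apply: (subsetP AU).
have [x1 x1P] : exists x, x \in I :\: A.
  by apply/set0Pn; rewrite -card_gt0 -cD card_gt0; apply/set0Pn; exists z0.
apply: (@leq_trans (#|A :\: I| * wt z)); last first.
  by rewrite -sum_nat_const; apply: leq_sum => x; apply: zmin.
rewrite cD -sum_nat_const (bigD1 x1) //= [X in _ < X](bigD1 x1) //= -addSn.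
by apply: leq_add; [apply: lt | apply: leq_sum => x /andP[/lt/ltnW]].
Qed.

End Colex.

(** * Shadows *)

Section Shadow.

Variables M N : nat.

Local Notation pt := {ffun 'I_M -> 'I_N.+2}.

Implicit Types (x y z u : pt) (e f c : 'I_M) (S : {set 'I_M}) (A B I U : {set pt}).

Definition lv1 : 'I_N.+2 := @Ordinal N.+2 1 isT.

Definition level S k : {set pt} := [set x | (supp x \subset S) && (#|supp x| == k)].

Definition shadow A : {set pt} :=
  [set u | [exists x in A, [exists e, (0 < x e) && (u == upd x e ord0)]]].

Lemma in_supp x e : (e \in supp x) = (0 < x e).
Proof. by rewrite inE. Qed.

Lemma shadowP A u :
  reflect (exists x e, [/\ x \in A, 0 < x e & u = upd x e ord0]) (u \in shadow A).
Proof.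
rewrite inE; apply: (iffP exists_inP) => [[x xA /existsP[e /andP[xe /eqP ->]]]|].
  by exists x, e.
by move=> [x [e [xA xe ->]]]; exists x => //; apply/existsP; exists e; rewrite xe eqxx.
Qed.

Lemma shadow_in A x e : x \in A -> 0 < x e -> upd x e ord0 \in shadow A.
Proof. by move=> xA xe; apply/shadowP; exists x, e. Qed.

Lemma supp_upd0 x e : supp (upd x e ord0) = supp x :\ e.
Proof. by apply/setP => f; rewrite !inE updE; case: eqVneq. Qed.

Lemma supp_upd x e (j : 'I_N.+2) : 0 < j -> supp (upd x e j) = e |: supp x.
Proof. by move=> j0; apply/setP => f; rewrite !inE updE; case: eqVneq. Qed.

Lemma level_out S k x e : x \in level S k -> e \notin S -> x e = ord0.
Proof.
rewrite inE => /andP[/subsetP sub _]; apply: contraNeq => xe; apply: sub.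
by rewrite inE lt0n.
Qed.

Lemma level_in S k x e : x \in level S k -> 0 < x e -> e \in S.
Proof. by move=> xl xe; apply: contraTT xe => /(level_out xl) ->. Qed.

Lemma level_del S k x e : x \in level S k.+1 -> 0 < x e -> upd x e ord0 \in level (S :\ e) k.
Proof.
rewrite !inE supp_upd0 => /andP[sub /eqP ck] xe; rewrite setSD //=.
by move: ck; rewrite (cardsD1 e) in_supp xe add1n => -[->].
Qed.

Lemma level_subset S S' k : S \subset S' -> level S k \subset level S' k.
Proof. by move=> sub; apply/subsetP => x; rewrite !inE => /andP[/subset_trans-> //]. Qed.

Lemma level_upd0 S k x e : x \in level S k.+1 -> 0 < x e -> upd x e ord0 \in level S k.
Proof. by move=> xl /(level_del xl); apply/subsetP/level_subset/subsetDl. Qed.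

Lemma level_add S k x e (j : 'I_N.+2) :
  x \in level S k -> e \in S -> x e = ord0 -> 0 < j -> upd x e j \in level S k.+1.
Proof.
rewrite !inE => /andP[sub /eqP ck] eS xe j0.
by rewrite supp_upd // subUset sub1set eS sub cardsU1 in_supp xe ck /= eqxx.
Qed.

Lemma level_chg S k x e (j : 'I_N.+2) :
  x \in level S k -> 0 < x e -> 0 < j -> upd x e j \in level S k.
Proof.
move=> xl xe j0; have eS := level_in xl xe; move: xl; rewrite !inE => /andP[sub /eqP ck].
by rewrite supp_upd // subUset sub1set eS sub (setUidPr _) ?sub1set ?in_supp ?ck ?xe /=.
Qed.

Lemma level_move S k x e f (j : 'I_N.+2) : x \in level S k -> 0 < x e -> f \in S ->
  (f = e \/ x f = ord0) -> 0 < j -> upd (upd x e ord0) f j \in level S k.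
Proof.
move=> xl xe fS h j0; have xk : 0 < k.
  by move: xl; rewrite inE => /andP[_ /eqP <-]; apply/card_gt0P; exists e; rewrite in_supp.
case: k xk xl => // k _ xl; apply: level_add => //; first exact: level_upd0.
by rewrite updE; case: eqP => // fe; case: h.
Qed.

Lemma shadow_level S k A : A \subset level S k.+1 -> shadow A \subset level S k.
Proof.
move=> Al; apply/subsetP => u /shadowP[x [e [xA xe ->]]].
by apply: level_upd0 => //; apply: (subsetP Al).
Qed.

Lemma level_absent S k x : x \in level S k -> k < #|S| -> exists2 e, e \in S & x e = ord0.
Proof.
rewrite inE => /andP[sub /eqP ck] lt.
have /properP[_ [e eS ex]] : supp x \proper S by rewrite properEcard sub ck.
exists e => //; apply/val_inj => /=; move: ex; rewrite inE; case: (nat_of_ord _) => //.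
Qed.

Lemma level_card S k x : x \in level S k -> k <= #|S|.
Proof. by rewrite inE => /andP[sub /eqP <-]; apply: subset_leq_card. Qed.

(* The least set of size k.+1 containing a given set of size k adds the lowest vertex
   of the first absent colour, and this operation is monotone. *)
Lemma shadow_initial S k I : initial (level S k.+1) I -> initial (level S k) (shadow I).
Proof.
move=> [Il hI]; split=> [|u v]; first exact: shadow_level.
move=> /shadowP[x [e0 [xI xe0 ->{u}]]] vl lt.
have xl := subsetP Il _ xI; have kS := level_card xl.
set u := upd x e0 ord0 in lt.
have e0S := level_in xl xe0.
have [a aS va] := level_absent vl kS.
case: (@arg_minnP _ a (fun e => (e \in S) && (v e == ord0)) (@nat_of_ord M)) => [|e1].
  by rewrite aS va eqxx.
move=> /andP[e1S /eqP ve1] e1min.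
have vpos f : f \in S -> f < e1 -> 0 < v f.
  move=> fS fe; rewrite lt0n; apply: contraTneq fe => vf; rewrite -leqNgt; apply: e1min.
  by rewrite fS /=; apply/eqP/val_inj.
(* The least cell over [v] fills its smallest absent colour [e1] at level one; it suffices that this
   cell does not come after [x]. *)
have yl : upd v e1 lv1 \in level S k.+1 by apply: level_add.
have -> : v = upd (upd v e1 lv1) e1 ord0 by rewrite upd_upd upd_same.
apply: shadow_in; last by rewrite upd_eq.
suff : wt (upd v e1 lv1) <= wt x.
  by rewrite leq_eqVlt => /orP[/eqP/wt_inj -> //|]; apply: hI.
have ux f : f != e0 -> u f = x f by move=> fe; rewrite upd_neq.
have ule : wt u < wt x by apply: wt_upd_lt.
have [e ve h] := colexP lt.
have ue : 0 < u e by apply: leq_ltn_trans ve.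
have eS : e \in S.
  apply: (level_in xl (e := e)); move: ue; rewrite updE; case: eqP => // _.
(* If the added vertex lies below the highest difference of [v] and [u], the new cell still precedes
   [u]. Otherwise that difference is the vertex of colour [e1] at level one. *)
case: (ltnP (pos e1 1) (pos e (u e))) => [big|small].
  apply: ltnW; apply: leq_trans _ (ltnW ule).
  apply: (colex_lt (e := e)) => [|f fe].
    rewrite updE; case: eqP => // ee; rewrite /= -ee in big *.
    by rewrite ltnNge -(leq_posE e) -ltnNge.
  rewrite updE; case: (eqVneq f e1) => [-> //|_ vu _].
  by case: (h f fe vu).
have [ue1 ee1] : nat_of_ord (u e) = 1 /\ e = e1.
  have ue1 : nat_of_ord (u e) = 1.
    apply/eqP; rewrite eqn_leq ue andbT leqNgt; apply/negP => /(pos_lt e1 e).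
    by rewrite ltnNge small.
  split=> //; apply/val_inj/eqP => /=; rewrite eqn_leq.
  rewrite ue1 in ve small; apply/andP; split; first by move: small; rewrite /pos leq_add2l.
  by rewrite leqNgt; apply/negP => /(vpos e eS); rewrite ltnNge -ltnS ve.
rewrite ee1 in ue1 ve h; clear e ee1 ue eS small.
(* Only level one in colours below [e1] is left for further differences, and there [v] has every
   colour of [S]. *)
have diff f : f != e1 -> v f != u f -> [/\ nat_of_ord (v f) = 1, nat_of_ord (u f) = 0 & f < e1].
  move=> fe vu; have [] := h f fe vu; rewrite ue1 => vf uf.
  have v1 := pos_lt_level vf; have u1 := pos_lt_level uf.
  have vu' : v f != u f :> nat by apply: contra_neq vu => /val_inj.
  have fe1 : f < e1.
    move: vf uf v1 u1 vu'; case: (nat_of_ord (v f)) => [|[|//]]; last by rewrite pos_lt_color.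
    by case: (nat_of_ord (u f)) => [|[|//]]; rewrite ?pos_lt_color.
  have fS : f \in S.
    case: (boolP (f \in S)) => // fS; case/eqP: vu; rewrite (level_out vl fS).
    by rewrite /u updE (level_out xl fS); case: eqP.
  have v0 := vpos f fS fe1.
  by move: v0 v1 u1 vu'; case: (nat_of_ord (v f)) => [|[|//]] //; case: (nat_of_ord (u f)) => [|[|//]].
(* Were [x] to precede the new cell, their highest difference [e2] would be a colour that [x] lacks,
   while the new cell has every colour of [x]; but both have [k.+1] vertices. *)
rewrite leqNgt; apply/negP => xy.
have [e2 xe2 h2] := colexP xy.
have u0 : u e0 = ord0 by rewrite upd_eq.
have e01 : e0 != e1 by apply: contra_eq_neq ue1 => <-; rewrite u0.
have e21 : e2 != e1.
  apply: contraTneq xe2 => ->; rewrite upd_eq -leqNgt /= -ux 1?eq_sym // ue1 //.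
have ye2 : upd v e1 lv1 e2 = v e2 by rewrite upd_neq.
have ye0 : upd v e1 lv1 e0 = v e0 by rewrite upd_neq.
have ux' f : u f <= x f by rewrite /u updE; case: eqP.
have [v2 u2 lt2] : [/\ nat_of_ord (v e2) = 1, nat_of_ord (u e2) = 0 & e2 < e1].
  apply: diff => //; apply: contraTneq xe2; rewrite ye2 => ->; rewrite -leqNgt; exact: ux'.
have x2 : nat_of_ord (x e2) = 0 by by move: xe2; rewrite ye2 v2 ltnS leqn0 => /eqP.
have e02 : e0 != e2 by apply: contraTneq xe0 => ->; rewrite x2.
have v0 : 0 < v e0.
  case: (eqVneq (x e0) (upd v e1 lv1 e0)) => [|neq].
    by rewrite ye0 => <-.
  have [] := h2 e0 e02 neq; rewrite ye2 v2 => px _.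
  have /eqP x1 : nat_of_ord (x e0) == 1 by rewrite eqn_leq xe0 (pos_lt_level px).
  by apply: vpos => //; rewrite x1 pos_lt_color in px; apply: ltn_trans lt2.
have sub : supp x \subset supp (upd v e1 lv1) :\ e2.
  apply/subsetP => f; rewrite !inE => xf; apply/andP; split.
    by apply: contraTneq xf => ->; rewrite x2.
  rewrite updE; case: eqP => // /eqP fe1; case: (eqVneq f e0) => [->//|fe0].
  case: (eqVneq (v f) (u f)) => [->|/(diff _ fe1)[->]//].
  by rewrite ux.
have := subset_leq_card sub; have := xl; have := yl; rewrite !inE => /andP[_ /eqP].
by rewrite (cardsD1 e2) in_supp ye2 v2 /= add1n => -[->] /andP[_ /eqP ->]; rewrite ltnn.
Qed.

End Shadow.
Arguments level {M N} S k.

(** * Compression in one colour *)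

Section Compression.

Variables M N : nat.

Local Notation pt := {ffun 'I_M -> 'I_N.+2}.

Local Notation level := (@level M N).

Implicit Types (x y z u : pt) (e f c : 'I_M) (S : {set 'I_M}) (A B I U : {set pt}).
Implicit Types (j : 'I_N.+2) (g : 'I_N.+2 -> nat).

(** The cells left out of this count avoid the bottom level; in the balanced complex each of them
    will carry a cross-polytope cycle. *)
Definition nonint S A : nat := #|[set x in A | [exists e in S, x e == lv1 N]]|.

Definition based S A : Prop :=
  forall x e, x \in A -> e \in S -> upd x e (lv1 N) \in A.

(** Stated as a predicate of the colour set, so that the induction on colours can assume it for
    [S :\ c]. *)
Definition macaulay S : Prop := forall k A, A \subset level S k ->
  #|shadow (seg (level S k) #|A|)| <= #|shadow A| /\
  (k = #|S| -> based S A -> nonint S (seg (level S k) #|A|) <= nonint S A).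

(** For positive [j] this is the link of the vertex of colour [c] at level [j]; for [j = ord0] it is
    the part of [A] that misses [c]. *)
Definition sec c j A : {set pt} := [set u : pt | (u c == ord0) && (upd u c j \in A)].

Definition lev k j : nat := if j == ord0 then k.+1 else k.

(** The family with prescribed initial segments as its sections in colour [c]. Both the compressions
    and the numerical estimates below use it. *)
Definition fam S c k g : {set pt} :=
  [set x in level S k.+1 |
    upd x c ord0 \in seg (level (S :\ c) (lev k (x c))) (g (x c))].

Lemma in_sec c j A u : (u \in sec c j A) = (u c == ord0) && (upd u c j \in A).
Proof. by rewrite inE. Qed.

Lemma sum_sec c A (F : pt -> nat) :
  \sum_(x in A) F x = \sum_j \sum_(u in sec c j A) F (upd u c j).
Proof.
rewrite (partition_big (fun x => x c) predT) //=; apply: eq_bigr => j _.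
rewrite (reindex_onto (fun u => upd u c j) (fun x => upd x c ord0)) /=; last first.
  by move=> x /andP[_ /eqP xc]; rewrite upd_upd upd_same.
apply: eq_bigl => u; rewrite in_sec upd_eq eqxx andbT andbC upd_upd; congr (_ && _).
apply/eqP/eqP => [<-|uc]; [exact: upd_eq | exact: upd_same].
Qed.

Lemma card_sec c A : #|A| = \sum_j #|sec c j A|.
Proof. by rewrite -sum1_card (sum_sec c); apply: eq_bigr => j _; rewrite sum1_card. Qed.

Lemma ord_gt0 j : (0 < j) = (j != ord0).
Proof. by rewrite lt0n. Qed.

Lemma sec_level S k c j A : c \in S -> A \subset level S k.+1 ->
  sec c j A \subset level (S :\ c) (lev k j).
Proof.
move=> cS /subsetP Al; apply/subsetP => u; rewrite in_sec => /andP[/eqP uc /Al ul].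
have {1}-> : u = upd (upd u c j) c ord0 by rewrite upd_upd upd_same.
rewrite /lev; case: eqP => [j0|/eqP j0]; last by apply: level_del; rewrite // upd_eq ord_gt0.
rewrite upd_upd -{1}j0; move: ul; rewrite !inE => /andP[sub ->].
rewrite andbT; apply/subsetP => e es; rewrite !inE (subsetP sub) // andbT.
by apply: contraTneq es => ->; rewrite in_supp upd_eq j0.
Qed.

Lemma sec_fam S k c j g : c \in S ->
  sec c j (fam S c k g) = seg (level (S :\ c) (lev k j)) (g j).
Proof.
move=> cS; apply/setP => u; rewrite in_sec inE upd_eq upd_upd.
apply/andP/idP => [[/eqP uc /andP[_]]|us]; first by rewrite upd_same.
have ul : u \in level (S :\ c) (lev k j) by apply: (subsetP (seg_sub _ _)) us.
have uc : u c = ord0 by apply: (level_out ul); rewrite !inE eqxx.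
split; first by rewrite uc.
rewrite (upd_same uc) us andbT; move: ul; rewrite /lev; case: eqP => [->|/eqP j0] ul.
  by rewrite upd_same //; apply: (subsetP (level_subset _ _ (subsetDl _ _))) ul.
apply: level_add => //; last by rewrite ord_gt0.
by apply: (subsetP (level_subset _ _ (subsetDl _ _))) ul.
Qed.

Lemma fam_level S c k g : fam S c k g \subset level S k.+1.
Proof. by apply/subsetP => x; rewrite inE => /andP[]. Qed.

Lemma sec_shadow c j A : 0 < j -> sec c j (shadow A) = shadow (sec c j A).
Proof.
move=> j0; apply/setP => u; rewrite in_sec; apply/andP/shadowP.
  move=> [uc /shadowP[x [e [xA xe ux]]]].
  have ec : c != e by apply: contraTneq j0 => ce; rewrite -(upd_eq u c j) ux ce upd_eq.
  have xc : x c = j by rewrite -(upd_eq u c j) ux upd_neq.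
  exists (upd x c ord0), e; split.
  - by rewrite in_sec upd_eq upd_upd upd_same // eqxx.
  - by rewrite upd_neq // eq_sym.
  - by rewrite updC // -ux upd_upd upd_same //; apply/eqP.
move=> [x [e [+ xe ->]]]; rewrite in_sec => /andP[xc xA].
have ec : e != c by apply: contraTneq xe => ->; rewrite (eqP xc).
split; first by rewrite upd_neq // eq_sym.
by rewrite updC //; apply: shadow_in; rewrite // upd_neq.
Qed.

(** A face without [c] arises from a cell without [c] by removing another colour, or from a cell
    with [c] by removing that very vertex. *)
Lemma sec0_shadow c A :
  sec c ord0 (shadow A) = shadow (sec c ord0 A) :|: \bigcup_(j | j != ord0) sec c j A.
Proof.
apply/setP => u; rewrite in_sec in_setU; apply/andP/orP.
  move=> [uc]; rewrite upd_same; last exact/eqP.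
  move=> /shadowP[x [e [xA xe ux]]]; case: (eqVneq c e) => [ce|ce].
    right; apply/bigcupP; exists (x c); first by rewrite -ord_gt0 ce.
    by rewrite in_sec uc /= ux ce upd_upd upd_id.
  left; rewrite ux; apply: shadow_in => //; rewrite in_sec.
  have xc : x c = ord0 by move: uc; rewrite ux upd_neq // => /eqP.
  by rewrite xc eqxx upd_same.
case=> [/shadowP[x [e [+ xe ->]]]|/bigcupP[j j0]]; rewrite in_sec => /andP[xc xA].
  have ec : e != c by apply: contraTneq xe => ->; rewrite (eqP xc).
  split; first by rewrite upd_neq // eq_sym.
  by rewrite updC //; apply: shadow_in; rewrite // upd_neq.
split=> //; rewrite -(upd_upd _ _ j); apply: shadow_in => //.
by rewrite upd_eq ord_gt0.
Qed.

Lemma card_seg_le U n : #|seg U n| <= n.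
Proof.
case: (leqP n #|U|) => [/card_seg -> //|lt].
by apply: leq_trans (ltnW lt); apply: subset_leq_card; apply: seg_sub.
Qed.

Lemma initial_sub_seg U I n : initial U I -> #|I| <= n -> I \subset seg U n.
Proof. by move=> hI le; apply: subset_trans (seg_subset U le); rewrite -(initial_seg hI). Qed.

(** In the part of the shadow that misses [c], all contributions are initial in the same level,
    hence nested; their union is no larger than the largest of them, which [P] bounds. *)
Lemma card_fam_shadow S c k g P : c \in S ->
  #|shadow (seg (level (S :\ c) k.+1) (g ord0))| <= P ->
  (forall j, j != ord0 -> g j <= P) ->
  #|shadow (fam S c k g)| <=
    P + \sum_(j | j != ord0) #|shadow (seg (level (S :\ c) k) (g j))|.
Proof.
move=> cS g0 gP; rewrite (card_sec c) (bigD1 ord0) //=; apply: leq_add; last first.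
  apply: eq_leq; apply: eq_bigr => j j0; rewrite sec_shadow ?ord_gt0 // sec_fam //.
  by rewrite /lev (negPf j0).
rewrite sec0_shadow; apply: leq_trans (card_seg_le (level (S :\ c) k) P).
apply: subset_leq_card; rewrite subUset sec_fam //; apply/andP; split.
  by apply: initial_sub_seg g0; apply/shadow_initial/seg_initial.
apply/bigcupsP => j j0; rewrite sec_fam // /lev (negPf j0).
by apply: seg_subset; apply: gP.
Qed.

Lemma nonint_sum S A : nonint S A = \sum_(x in A) [exists e in S, x e == lv1 N].
Proof.
rewrite /nonint -sum1_card big_mkcond [RHS]big_mkcond /=; apply: eq_bigr => x _.
by rewrite inE; case: (x \in A) => //=; case: [exists _ in _, _].
Qed.

Lemma nonint_sec S c A : c \in S ->
  nonint S A = #|sec c (lv1 N) A| + \sum_(j | j != lv1 N) nonint (S :\ c) (sec c j A).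
Proof.
move=> cS; rewrite nonint_sum (sum_sec c) (bigD1 (lv1 N)) //=; congr (_ + _).
  rewrite -sum1_card; apply: eq_bigr => u _.
  by rewrite (introT exists_inP) //; exists c; rewrite // upd_eq.
apply: eq_bigr => j j1; rewrite nonint_sum; apply: eq_bigr => u _.
congr (nat_of_bool _); apply/exists_inP/exists_inP => -[e eS h].
  case: (eqVneq e c) h => [->|ec h]; first by rewrite upd_eq (negPf j1).
  by exists e; rewrite ?inE ?ec // upd_neq in h *.
move: eS; rewrite !inE => /andP[ec eS]; exists e => //; by rewrite upd_neq.
Qed.

Lemma based_sec S c j A : based S A -> based (S :\ c) (sec c j A).
Proof.
move=> bA u e; rewrite !in_sec !inE => /andP[uc uA] /andP[ec eS].
by rewrite upd_neq ?uc 1?eq_sym //= updC //; apply: bA.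
Qed.

Lemma sec_sub_lv1 S c j A : c \in S -> based S A -> sec c j A \subset sec c (lv1 N) A.
Proof.
move=> cS bA; apply/subsetP => u; rewrite !in_sec => /andP[-> /= uA].
by rewrite -(upd_upd _ _ j); apply: bA.
Qed.

Lemma level_full S k u e : k = #|S| -> u \in level S k -> e \in S -> 0 < u e.
Proof.
move=> kS; rewrite inE => /andP[sub /eqP ck] eS.
have /setP/(_ e) : supp u = S by apply/eqP; rewrite eqEcard sub ck kS /=.
by rewrite eS in_supp.
Qed.

Lemma sec0_full S k c A : k.+1 = #|S| -> c \in S -> A \subset level S k.+1 -> sec c ord0 A = set0.
Proof.
move=> kS cS Al; apply/setP => u; rewrite in_sec inE; apply/negP => /andP[_ /(subsetP Al) ul].
by have := level_full kS ul cS; rewrite upd_eq.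
Qed.

Lemma initial_based S k I : k = #|S| -> initial (level S k) I -> based S I.
Proof.
move=> kS [Il hI] x e xI eS; have xl := subsetP Il _ xI.
have xe := level_full kS xl eS.
case: (eqVneq (x e) (lv1 N)) => [<-|neq]; first by rewrite upd_id.
apply: (hI _ _ xI); first exact: level_chg.
apply: wt_upd_lt; rewrite /= ltn_neqAle xe andbT eq_sym.
by apply: contra neq => /eqP h; apply/eqP/val_inj.
Qed.

Lemma fam_based S k c g : k.+1 = #|S| -> c \in S ->
  (forall j, j != ord0 -> g j <= g (lv1 N)) -> based S (fam S c k g).
Proof.
move=> kS cS gle x e xf eS; have xl := subsetP (fam_level _ _ _ _) _ xf.
have xc := level_full kS xl cS; have xe := level_full kS xl eS.
have xc0 : x c != ord0 by rewrite -ord_gt0.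
rewrite inE level_chg //=; move: xf; rewrite inE xl /= => xf.
case: (eqVneq e c) => [->|ec].
  rewrite upd_eq upd_upd; move: xf; rewrite /lev (negPf xc0) /=.
  by apply/subsetP/seg_subset/gle.
rewrite upd_neq 1?eq_sym // updC //.
move: xf; rewrite /lev (negPf xc0) => xf.
have kc : k = #|S :\ c| by move: kS; rewrite (cardsD1 c) cS => -[].
apply: (initial_based kc (seg_initial _ _)) => //.
by rewrite !inE ec.
Qed.

Lemma fam_card S k c g : c \in S -> (forall j, g j <= #|level (S :\ c) (lev k j) : {set pt}|) ->
  #|fam S c k g| = \sum_j g j.
Proof.
by move=> cS h; rewrite (card_sec c); apply: eq_bigr => j _; rewrite sec_fam // card_seg.
Qed.

Definition compress S c k A : {set pt} := fam S c k (fun j => #|sec c j A|).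

(** * Effect of a single compression *)

Section Compress.

Variables (S : {set 'I_M}) (c : 'I_M) (k : nat) (A : {set pt}).
Hypotheses (cS : c \in S) (Al : A \subset level S k.+1).

Lemma compress_sec j : sec c j (compress S c k A) = seg (level (S :\ c) (lev k j)) #|sec c j A|.
Proof. exact: sec_fam. Qed.

Lemma compress_card : #|compress S c k A| = #|A|.
Proof.
rewrite fam_card // => [|j]; first by rewrite -card_sec.
by apply: subset_leq_card; apply: sec_level.
Qed.

(** Putting the vertex of colour [c] back adds the same weight to all cells of a section, so by
    [initial_sum_wt] each section that changes loses weight. *)
Lemma compress_wt : compress S c k A <> A ->
  \sum_(x in compress S c k A) wt x < \sum_(x in A) wt x.
Proof.
move=> neq; rewrite !(sum_sec c).
have wsum j B : \sum_(u in sec c j B) wt (upd u c j) =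
    \sum_(u in sec c j B) wt u + #|sec c j B| * bit c j.
  rewrite -sum_nat_const -big_split /=; apply: eq_bigr => u.
  rewrite in_sec => /andP[/eqP uc _]; have := wt_upd u c j.
  by rewrite uc bit0 addn0.
have cardE j : #|sec c j (compress S c k A)| = #|sec c j A|.
  by rewrite compress_sec card_seg // subset_leq_card // sec_level.
have le j : sec c j (compress S c k A) = sec c j A \/
   \sum_(u in sec c j (compress S c k A)) wt u < \sum_(u in sec c j A) wt u.
  case: (eqVneq (sec c j A) (sec c j (compress S c k A))) => [->|ne]; [by left|right].
  rewrite compress_sec in ne *; apply: (initial_sum_wt (seg_initial _ _)) ne.
  - exact: sec_level.
  - by rewrite card_seg // subset_leq_card // sec_level.
have [j0 ne] : exists j, sec c j (compress S c k A) != sec c j A.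
  apply/existsP; rewrite -negb_forall; apply/negP => /forallP h; apply: neq.
  apply/setP => x; have /eqP/setP/(_ (upd x c ord0)) := h (x c).
  by rewrite !in_sec upd_eq eqxx upd_upd upd_id.
rewrite (bigD1 j0) //= [X in _ < X](bigD1 j0) //= -addSn.
apply: leq_add; rewrite ?wsum ?cardE.
  by rewrite ltn_add2r; case: (le j0) => // e; rewrite e eqxx in ne.
apply: leq_sum => j _; rewrite !wsum cardE leq_add2r.
by case: (le j) => [->//|/ltnW].
Qed.

(** [P] counts the faces of [A] missing [c], among which are the shadow of the section at level zero
    and all the other sections. Faces containing [c] are compared section by section. *)
Lemma compress_shadow : macaulay (S :\ c) -> #|shadow (compress S c k A)| <= #|shadow A|.
Proof.
move=> mac; set P := #|sec c ord0 (shadow A)|.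
have := @card_fam_shadow S c k (fun j => #|sec c j A|) P cS.
rewrite -/(compress S c k A) => h; apply: leq_trans (h _ _) _ => {h}.
- apply: leq_trans (proj1 (mac _ _ (sec_level ord0 cS Al))) _.
  by apply: subset_leq_card; rewrite sec0_shadow subsetUl.
- move=> j j0; apply: subset_leq_card; rewrite sec0_shadow; apply: subsetU; apply/orP; right.
  exact: (bigcup_sup j).
rewrite [X in _ <= X](card_sec c) [X in _ <= X](bigD1 ord0) //= leq_add2l; apply: leq_sum => j j0.
rewrite sec_shadow ?ord_gt0 //; have := proj1 (mac _ _ (sec_level j cS Al)).
by rewrite /lev (negPf j0).
Qed.

Lemma compress_based : k.+1 = #|S| -> based S A -> based S (compress S c k A).
Proof.
by move=> kS bA; apply: fam_based => // j _; apply: subset_leq_card; apply: sec_sub_lv1 bA.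
Qed.

(** The section at level one counts in full and does not grow, the section at level zero is empty
    because all colours occur, and the hypothesis on [S :\ c] covers the rest. *)
Lemma compress_nonint : macaulay (S :\ c) -> k.+1 = #|S| -> based S A ->
  nonint S (compress S c k A) <= nonint S A.
Proof.
move=> mac kS bA; rewrite !(@nonint_sec S c) //; apply: leq_add.
  by rewrite compress_sec card_seg_le.
apply: leq_sum => j _; case: (eqVneq j ord0) => [->|j0].
  rewrite (sec0_full kS cS) ?fam_level // (sec0_full kS cS) //.
rewrite compress_sec; have := proj2 (mac _ _ (sec_level j cS Al)).
apply; last exact: based_sec.
by rewrite /lev (negPf j0); move: kS; rewrite (cardsD1 c S) cS => -[].
Qed.

End Compress.

End Compression.

(** * Families fixed by all compressions *)

Section Exchange.

Variables M N : nat.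

Local Notation pt := {ffun 'I_M -> 'I_N.+2}.

Local Notation level := (@level M N).

Implicit Types (u v z : pt) (e f : 'I_M) (A B I U X Y : {set pt}) (j : 'I_N.+2).

Definition improves (S : {set 'I_M}) k B A : Prop :=
  [/\ B \subset level S k, #|B| = #|A|, \sum_(u in B) wt u < \sum_(u in A) wt u,
      #|shadow B| <= #|shadow A|
    & k = #|S| -> based S A -> based S B /\ nonint S B <= nonint S A].

Lemma card_exchange A X Y : Y \subset A -> [disjoint A & X] -> #|X| = #|Y| ->
  #|(A :\: Y) :|: X| = #|A|.
Proof.
move=> YA dis XY; rewrite cardsU (_ : _ :&: X = set0) ?cards0 ?subn0.
  by rewrite XY cardsD (setIidPr YA) subnK // subset_leq_card.
apply/eqP; rewrite setI_eq0; apply: disjointWl dis; exact: subsetDl.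
Qed.

Lemma sum_exchange A X Y (F : pt -> nat) : Y \subset A -> [disjoint A & X] ->
  \sum_(u in (A :\: Y) :|: X) F u = \sum_(u in A :\: Y) F u + \sum_(u in X) F u.
Proof.
move=> YA dis; rewrite -bigU /=; last by apply: disjointWl dis; exact: subsetDl.
by apply: eq_bigl => u; rewrite !inE.
Qed.

Lemma sum_setD A Y (F : pt -> nat) : Y \subset A ->
  \sum_(u in A) F u = \sum_(u in A :\: Y) F u + \sum_(u in Y) F u.
Proof. by move=> YA; rewrite (big_setID Y) /= (setIidPr YA) addnC. Qed.

Variables (S : {set 'I_M}) (k : nat) (A : {set pt}).

Hypothesis Al : A \subset level S k.+1.

(** This is what invariance under every compression provides. *)
Hypothesis stable : forall c u v, c \in S -> u \in A -> v \in level S k.+1 ->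
  u c = v c -> wt v < wt u -> v \in A.

Variables x y : pt.
Hypotheses (xl : x \in level S k.+1) (xA : x \notin A) (yA : y \in A) (xy : wt x < wt y).
Hypothesis xmin : forall z, z \in level S k.+1 -> wt z < wt x -> z \in A.
Hypothesis ymax : forall z, z \in A -> wt z <= wt y.

Let yl : y \in level S k.+1.
Proof. exact: (subsetP Al). Qed.

Lemma exchange_diff c : c \in S -> x c != y c.
Proof. by move=> cS; apply: contraNneq xA => e; apply: (stable cS yA). Qed.

(** The colours [e] such that, for a cell [z], the least cell over the face [z] without [e] is [z]
    itself. *)
Definition small z : {set 'I_M} := [set e in S | (z e == lv1 N) &&
  [forall f in S, (f < e) ==> (0 < z f)]].

Lemma smallP z e : reflect [/\ e \in S, z e = lv1 N & forall f, f \in S -> f < e -> 0 < z f]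
  (e \in small z).
Proof.
rewrite inE; apply: (iffP and3P) => [[eS /eqP ze /forall_inP h]|[eS -> h]]; split=> //.
  by move=> f fS; apply/implyP; apply: h.
by apply/forall_inP => f fS; apply/implyP; apply: h.
Qed.

(** Either the vertex of colour [e] can be lowered to level one, or it can be replaced by a smaller
    absent colour at level one. *)
Lemma old_face e : 0 < x e -> e \notin small x ->
  exists z f, [/\ z \in level S k.+1, wt z < wt x, 0 < z f & upd z f ord0 = upd x e ord0].
Proof.
move=> xe es; have eS := level_in xl xe.
case: (eqVneq (x e) (lv1 N)) => [x1|x1]; last first.
  exists (upd x e (lv1 N)), e; rewrite upd_upd upd_eq; split=> //.
    exact: level_chg.
  apply: wt_upd_lt; rewrite /= ltn_neqAle xe andbT eq_sym.
  by apply: contra x1 => /eqP h; apply/eqP/val_inj.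
have [f [fS fe xf]] : exists f, [/\ f \in S, f < e & x f = ord0].
  move: es; rewrite inE eS x1 eqxx /= => /forall_inPn[f fS].
  rewrite negb_imply -leqNgt leqn0 => /andP[fe /eqP xf]; exists f; split=> //.
  exact: val_inj.
have fe' : f != e by apply: contraTneq fe => ->; rewrite ltnn.
exists (upd (upd x e ord0) f (lv1 N)), f; rewrite upd_upd upd_eq; split=> //.
- by apply: level_move => //; right.
- have := wt_upd (upd x e ord0) f (lv1 N); have := wt_upd x e ord0.
  rewrite upd_neq // xf !bit0 !addn0 => <- ->; rewrite ltn_add2l x1.
  by apply: ltn_bit => //; rewrite pos_lt_color.
- by rewrite (upd_same (j := ord0)) // upd_neq.
Qed.

(** [y] is the least cell over this face, so any other cell of [A] over it would come after [y], the
    last cell of [A]. *)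
Lemma new_face e z f : e \in small y -> z \in A -> z != y -> 0 < z f ->
  upd z f ord0 != upd y e ord0.
Proof.
move=> /smallP[eS ye h] zA zy zf; apply: contraTneq (ymax zA) => zye; rewrite -ltnNge.
have fS : f \in S by apply: level_in zf; apply: (subsetP Al).
have yz : z = upd (upd y e ord0) f (z f) by rewrite -zye upd_upd upd_id.
case: (eqVneq f e) => [fe|fe].
  rewrite yz fe upd_upd; apply: wt_upd_gt; rewrite ye /= ltn_neqAle -fe zf andbT.
  apply: contra zy => /eqP h1; rewrite yz fe upd_upd upd_same // ye.
  by apply: val_inj; rewrite /= h1 fe.
have yf : y f = ord0 by rewrite -(upd_neq y (e := e) ord0 fe) -zye upd_eq.
have := wt_upd (upd y e ord0) f (z f); have := wt_upd y e ord0.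
rewrite upd_neq // yf -yz !bit0 !addn0 => <- ->; rewrite ltn_add2l ye.
apply: ltn_bit => //; apply: (@leq_trans (pos f 1)); last by rewrite leq_posE.
rewrite pos_lt_color ltn_neqAle eq_sym; apply/andP; split.
  by apply: contra fe => /eqP h1; apply/eqP/val_inj.
by rewrite leqNgt; apply/negP => /(h f fS); rewrite yf.
Qed.

(** * Comparison of [x] with the highest vertex of [y], of colour [c] *)

Section Top.

Variable c : 'I_M.
Hypothesis yc : 0 < y c.
Hypothesis ctop : forall f, 0 < y f -> pos f (y f) <= pos c (y c).

Let cS : c \in S := level_in yl yc.

(** [x] and [y] agree in no colour of [S], so every vertex of [x] lies below their highest
    difference, which is a vertex of [y]. *)
Lemma top_lt f : 0 < x f -> pos f (x f) < pos c (y c).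
Proof.
move=> xf; have [e lt h] := colexP xy.
have ye : 0 < y e by apply: leq_ltn_trans lt.
apply: leq_trans (ctop ye); case: (eqVneq f e) => [->|fe]; first exact: pos_lt.
by case: (h f fe) => //; apply: exchange_diff; apply: (level_in xl xf).
Qed.

Lemma top_wt : wt x < 2 ^ pos c (y c).
Proof. by apply: sum_bit_lt => f _; apply: top_lt. Qed.

Lemma wt_top z : z c = y c -> 2 ^ pos c (y c) <= wt z.
Proof. by move=> zc; have := leq_bit_wt z c; rewrite zc bit_pos. Qed.

(** Otherwise exchanging the vertex of [x] into [y] gives a cell between [x] and [y] that shares [c]
    with [y] and [f] with [x]; stability then carries membership in [A] from [y] to [x]. *)
Lemma no_lower_x e f : e != c -> 0 < x f -> 0 < y e -> f = e \/ y f = ord0 ->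
  pos e (y e) <= pos f (x f).
Proof.
move=> ec xf ye h; rewrite leqNgt; apply: contra xA => lt.
have fS := level_in xl xf.
have fc : c != f.
  by case: h => [->|yf]; [rewrite eq_sym | apply: contraTneq yc => ->; rewrite yf].
set z := upd (upd y e ord0) f (x f).
have zl : z \in level S k.+1 by apply: level_move => //.
have zc : z c = y c by rewrite !upd_neq // eq_sym.
have zy : wt z < wt y.
  have := wt_upd (upd y e ord0) f (x f); have := wt_upd y e ord0.
  have -> : upd y e ord0 f = ord0 by rewrite updE; case: eqP h => // fe [|].
  rewrite -/z !bit0 !addn0 => <- ->; rewrite ltn_add2l.
  exact: ltn_bit.
have zA : z \in A by apply: (stable cS yA).
apply: (stable fS zA) => //; first by rewrite upd_eq.
exact: leq_trans top_wt (wt_top zc).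
Qed.

(** The dual exchange, of the vertex of [y] into [x], gives a cell between them that shares [e] with
    [y] and a further colour [g] with [x]. *)
Lemma no_lower_y e f : e != c -> 0 < x f -> 0 < y e -> x e = ord0 ->
  pos e (y e) <= pos f (x f).
Proof.
move=> ec xf ye xe; rewrite leqNgt; apply: contra xA => lt.
have eS := level_in yl ye.
set z := upd (upd x f ord0) e (y e).
have zl : z \in level S k.+1 by apply: level_move => //; right.
have fe : e != f by apply: contraTneq xf => <-; rewrite xe.
have xz : wt x < wt z.
  have := wt_upd (upd x f ord0) e (y e); have := wt_upd x f ord0.
  rewrite upd_neq // xe -/z !bit0 !addn0 => <- ->; rewrite ltn_add2l.
  exact: ltn_bit.
have zy : wt z < wt y.
  apply: leq_trans (wt_top (erefl _)); apply: sum_bit_lt => g _.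
  rewrite !updE; case: (eqVneq g e) => [-> _|_].
    rewrite ltn_neqAle ctop // andbT; apply: contra ec => /eqP/pos_inj[-> _] //.
  by case: eqP => // _; apply: top_lt.
have zA : z \in A by apply: (stable eS yA) => //; rewrite upd_eq.
(* [x] has a second vertex because [y] has two, of colours [c] and [e]. *)
have [g xg gf] : exists2 g, 0 < x g & g != f.
  have : 0 < #|supp x :\ f|.
    have := xl; have := yl; rewrite !inE => /andP[_ /eqP yk] /andP[_ /eqP xk].
    have : 1 < #|supp x|.
      by rewrite xk -yk (cardsD1 c) (cardsD1 e) !inE yc ye ec.
    by rewrite (cardsD1 f) in_supp xf.
  by case/card_gt0P => g; rewrite !inE => /andP[gf xg]; exists g.
apply: (stable (level_in xl xg) zA) => //.
rewrite upd_neq; last by apply: contraTneq xg => ->; rewrite xe.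
by rewrite upd_neq.
Qed.

(** By [no_lower_x] the vertices of [y] other than [c] have level one and colours below [f], and [x]
    has all these colours since [f] is in [small x]. Counting leaves no slack: besides [c] and [f],
    both use exactly the colours of [S] below [f]. *)
Lemma small_top f : 0 < k -> f \in small x -> f != c -> small x = [set f] /\ small y != set0.
Proof.
move=> k0 /smallP[fS xf h] fc.
have xf0 : 0 < x f by rewrite xf.
have yf : y f = ord0.
  apply/eqP; apply: contraNT (exchange_diff fS); rewrite -ord_gt0 => yf.
  have := no_lower_x fc xf0 yf (or_introl (erefl _)); rewrite xf leq_posE => y1.
  by apply/eqP/val_inj/eqP; rewrite /= eqn_leq yf y1.
have ylow e : e != c -> 0 < y e -> y e = lv1 N /\ e < f.
  move=> ec ye; have := no_lower_x ec xf0 ye (or_intror yf); rewrite xf leq_eqVlt.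
  case/orP => [/eqP/pos_inj[ef]|lt]; first by rewrite ef yf in ye.
  have y1 : y e = lv1 N.
    by apply/val_inj/eqP; rewrite /= eqn_leq ye (pos_lt_level lt).
  by rewrite y1 pos_lt_color in lt.
pose L := [set e in S | e < f].
have ysub : supp y :\ c \subset L.
  apply/subsetP => e; rewrite !inE => /andP[ec ye]; case: (ylow e ec ye) => _ ->.
  by rewrite (level_in yl ye).
have xsub : f |: L \subset supp x.
  apply/subsetP => e; rewrite !inE => /orP[/eqP -> //|/andP[eS ef]]; exact: h.
have fL : f \notin L by rewrite inE ltnn andbF.
have yk : #|supp y :\ c| = k.
  by have := yl; rewrite inE => /andP[_]; rewrite (cardsD1 c (supp y)) in_supp yc add1n eqSS => /eqP.
have xk : #|supp x| = k.+1 by have := xl; rewrite inE => /andP[_ /eqP].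
have Lk : #|L| = k.
  have := subset_leq_card ysub; rewrite yk => kL; apply/eqP; rewrite eqn_leq kL andbT.
  by have := subset_leq_card xsub; rewrite cardsU1 fL xk.
have yL : supp y :\ c = L by apply/eqP; rewrite eqEcard ysub yk Lk /=.
have xL : f |: L = supp x by apply/eqP; rewrite eqEcard xsub cardsU1 fL xk Lk /=.
have y1 e : e \in L -> y e = lv1 N.
  by rewrite -yL !inE => /andP[ec ye]; case: (ylow e ec ye).
split.
  apply/setP => e; rewrite in_set1; apply/idP/eqP => [/smallP[eS xe _]|->]; last first.
    exact/smallP.
  have : e \in supp x by rewrite in_supp xe.
  rewrite -xL !inE => /orP[/eqP //|eL]; have := exchange_diff eS.
  by rewrite xe y1 ?eqxx // inE.
have /card_gt0P[g gL] : 0 < #|L| by rewrite Lk.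
apply/set0Pn; exists g; apply/smallP; split; first by move: gL; rewrite inE => /andP[].
  exact: y1.
move=> e eS eg; rewrite y1 // inE eS; move: gL; rewrite inE => /andP[_]; exact: ltn_trans.
Qed.

(** In the first two cases replacing [y] by [x] gains no more faces than it loses. In the third [x]
    may gain a face, while [small y] is empty and [y] need not lose one. *)
Lemma small_trichotomy : 0 < k ->
  [\/ small x = set0,
      (exists2 f, small x = [set f] & small y != set0)
    | [/\ k.+1 = #|S|, x c = lv1 N, forall e, e \in S -> 1 < y e
        & forall e, e \in S -> e != c -> y e < x e]].
Proof.
move=> k0; case: (set_0Vmem (small x)) => [->|[f fs]]; [by constructor 1|].
case: (eqVneq f c) => [fc|fc]; last first.
  by have [h1 h2] := small_top k0 fs fc; constructor 2; exists f.
rewrite {f}fc in fs; case: (eqVneq (small y) set0) => [y0|]; last first.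
  constructor 2; exists c => //; apply/setP => e; rewrite in_set1.
  apply/idP/eqP => [es|-> //]; apply/eqP; apply: contraTT fs => ec.
  by have [-> _] := small_top k0 es ec; rewrite in_set1 eq_sym.
constructor 3; have /smallP[_ xc h] := fs.
have xc0 : 0 < x c by rewrite xc.
have xfull e : e \in S -> 0 < x e.
  move=> eS; rewrite ord_gt0; apply/negP => /eqP xe.
  have ye : 0 < y e by rewrite ord_gt0 -xe eq_sym exchange_diff.
  have ec : e != c by apply: contraTneq xc0 => <-; rewrite xe.
  have := no_lower_y ec xc0 ye xe; rewrite leqNgt => /negP; apply.
  rewrite xc; apply: (@leq_trans (pos e 1)); last by rewrite leq_posE.
  rewrite pos_lt_color ltn_neqAle eq_sym; apply/andP; split.
    by apply: contra ec => /eqP h1; apply/eqP/val_inj.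
  by rewrite leqNgt; apply/negP => /(h e eS); rewrite xe.
have xS : supp x = S.
  apply/setP => e; rewrite in_supp; apply/idP/idP => [/(level_in xl)//|]; exact: xfull.
have kS : k.+1 = #|S| by have := xl; rewrite inE xS => /andP[_ /eqP].
have yfull e : e \in S -> 0 < y e by move=> eS; exact: level_full kS yl eS.
have y2 e : e \in S -> 1 < y e.
  move=> eS; rewrite ltn_neqAle yfull // andbT; apply/eqP => y1.
  suff : e \in small y by rewrite y0 inE.
  by apply/smallP; split=> // [|f fS _]; [exact: val_inj | apply: yfull].
split=> // e eS ec; have := no_lower_x ec (xfull e eS) (yfull e eS) (or_introl (erefl _)).
rewrite leq_posE => yx.
rewrite ltn_neqAle yx andbT; apply: contra (exchange_diff eS) => /eqP h1.
by apply/eqP/val_inj; rewrite /= h1.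
Qed.

End Top.

Lemma xmin_neq z : z \in level S k.+1 -> wt z < wt x -> z \in A :\ y.
Proof.
move=> zl zx; rewrite !inE xmin // andbT.
by apply: contraTneq zx => ->; rewrite -leqNgt ltnW.
Qed.

Lemma wt_lv1 z e : 0 < z e -> upd z e (lv1 N) != z -> wt (upd z e (lv1 N)) < wt z.
Proof.
move=> ze neq; apply: wt_upd_lt; rewrite /= ltn_neqAle ze andbT.
apply: contra neq => /eqP h; rewrite upd_same //; exact/val_inj.
Qed.

Lemma simple_exchange :
  (k = 0 \/ small x = set0 \/ exists2 f, small x = [set f] & small y != set0) ->
  improves S k.+1 (x |: (A :\ y)) A.
Proof.
move=> cases; rewrite setUC.
have YA : [set y] \subset A by rewrite sub1set.
have dis : [disjoint A & [set x]] by rewrite disjoint_sym disjoints1.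
have Bl : A :\ y :|: [set x] \subset level S k.+1.
  by rewrite subUset sub1set xl (subset_trans (subsetDl _ _)).
have old u f : u \in A :\ y -> 0 < u f -> upd u f ord0 \in shadow A.
  by rewrite inE => /andP[_]; apply: shadow_in.
split=> //.
- by rewrite card_exchange // !cards1.
- by rewrite sum_exchange // (sum_setD _ YA) !big_set1 ltn_add2l.
- case: cases => [k0|[x0|[f xf /set0Pn[g gy]]]].
  (* Cells with a single vertex have only the empty face in their shadow. *)
  + have sub : shadow (A :\ y :|: [set x]) \subset [set [ffun=> ord0]].
      apply: subset_trans (shadow_level Bl) _; rewrite k0; apply/subsetP => u.
      rewrite !inE => /andP[_ /eqP/cards0_eq u0]; apply/eqP/ffunP => e; rewrite ffunE.
      by apply/val_inj/eqP; rewrite /= -leqn0 leqNgt -in_supp u0 inE.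
    apply: leq_trans (subset_leq_card sub) _; rewrite cards1; apply/card_gt0P.
    have [e ye] : exists e, e \in supp y.
      by apply/card_gt0P; have := yl; rewrite inE => /andP[_ /eqP ->].
    by exists (upd y e ord0); apply: shadow_in; rewrite // -in_supp.
  + apply: subset_leq_card; apply/subsetP => u /shadowP[z [e [+ ze ->]]].
    rewrite in_setU in_set1 => /orP[zA|/eqP zx]; first exact: old.
    rewrite zx in ze *; have [|z' [e' [z'l lt z'e <-]]] := @old_face e ze.
      by rewrite x0 inE.
    by apply: shadow_in => //; apply: xmin.
  + have gA : upd y g ord0 \in shadow A.
      by apply: shadow_in => //; case/smallP: gy => _ ->.
    apply: (@leq_trans #|upd x f ord0 |: (shadow A :\ upd y g ord0)|); last first.
      by rewrite (cardsD1 (upd y g ord0) (shadow A)) gA cardsU1 leq_add2r; case: (_ \notin _).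
    have sub u e : u \in A :\ y -> 0 < u e -> upd u e ord0 \in shadow A :\ upd y g ord0.
      move=> uA ue; rewrite in_setD1 old // andbT; move: uA; rewrite !inE => /andP[uy uA].
      exact: new_face.
    apply: subset_leq_card; apply/subsetP => u /shadowP[z [e [+ ze ->]]].
    rewrite in_setU in_set1 => /orP[zA|/eqP zx]; first by rewrite in_setU sub ?orbT.
    rewrite zx in ze *; case: (boolP (e \in small x)) => [|es].
      by rewrite xf in_set1 => /eqP ->; rewrite in_setU in_set1 eqxx.
    have [z' [e' [z'l lt z'e <-]]] := @old_face e ze es.
    by rewrite in_setU sub ?orbT //; apply: xmin_neq.
(* Lowering vertices never turns another cell of [A] into [y], the last one, and turns [x] into
   itself or an earlier cell. *)
move=> kS bA; split.
  move=> z e; rewrite !inE => /orP[/andP[zy zA]|/eqP ->] eS.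
    rewrite (bA z e zA eS) andbT; apply/orP; left; apply/eqP => h.
    have ze : 0 < z e by apply: level_full kS _ eS; apply: (subsetP Al).
    have := ymax zA; case: (eqVneq (upd z e (lv1 N)) z) => [zz|/(wt_lv1 ze)].
      by rewrite -h zz eqxx in zy.
    by rewrite h ltnNge => /negPf ->.
  have xe : 0 < x e by apply: level_full kS xl eS.
  case: (eqVneq (upd x e (lv1 N)) x) => [->|/(wt_lv1 xe) lt]; first by rewrite orbT.
  have := xmin_neq (level_chg (j := lv1 N) xl xe isT) lt.
  by rewrite in_setD1 => ->.
rewrite !nonint_sum sum_exchange // (sum_setD _ YA) !big_set1 leq_add2l.
suff : [exists e in S, x e == lv1 N] -> [exists e in S, y e == lv1 N].
  by case: [exists e in S, x e == _] => // ->.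
move=> /exists_inP[e eS /eqP xe]; apply/exists_inP.
have xs : e \in small x.
  by apply/smallP; split=> // f fS _; apply: level_full kS xl fS.
case: cases => [k0|[x0|[_ _ /set0Pn[g /smallP[gS yg _]]]]]; last by exists g; rewrite ?yg.
  (* With a single colour at level one, [based] already puts [x] in [A]. *)
  have /eqP/cards1P[d Sd] : #|S| = 1 by rewrite -kS k0.
  exfalso; move/negP: xA; apply; have -> : x = upd y e (lv1 N); last exact: bA.
  apply/ffunP => f; rewrite updE; case: (eqVneq f e) => [->//|fe].
  have fS : f \notin S by move: eS; rewrite Sd !in_set1 => /eqP <-.
  by rewrite (level_out xl fS) (level_out yl fS).
by rewrite x0 inE in xs.
Qed.

(** * Exchange of several cells at once, in the remaining case *)

Section Special.

Variable c : 'I_M.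
Hypothesis yc : 0 < y c.
Hypothesis ctop : forall f, 0 < y f -> pos f (y f) <= pos c (y c).
Hypotheses (k0 : 0 < k) (kS : k.+1 = #|S|) (xc : x c = lv1 N).
Hypothesis y2 : forall e, e \in S -> 1 < y e.
Hypothesis yx : forall e, e \in S -> e != c -> y e < x e.

Let cS : c \in S := level_in yl yc.

(* All cells of A over the face y minus its lowest vertex make room for as many
   cells over the face x minus its lowest vertex c: one face is lost, one is gained. *)
Lemma special_exchange : exists B, improves S k.+1 B A.
Proof.
have [a /andP[aS ac]] : exists e, (e \in S) && (e != c).
  have : 0 < #|S :\ c| by move: kS; rewrite (cardsD1 c) cS add1n => -[<-].
  by case/card_gt0P => e; rewrite !inE andbC => ?; exists e.
case: (@arg_minnP _ a (fun e => (e \in S) && (e != c)) (fun e => y e)) => [|w].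
  by rewrite aS.
move=> /andP[wS wc] wmin; clear a aS ac.
(* As [w] has the lowest level in [y] outside [c], every level in [J] is below all levels of [x]
   outside [c]. *)
pose J := [set j : 'I_N.+2 | 0 < j <= y w].
have yw : 0 < y w := ltnW (y2 wS).
pose Y := [set upd y w j | j in J]; pose X := [set upd x c j | j in J].
have injY : {in J &, injective (upd y w)}.
  by move=> i j _ _ /ffunP/(_ w); rewrite !upd_eq.
have injX : {in J &, injective (upd x c)}.
  by move=> i j _ _ /ffunP/(_ c); rewrite !upd_eq.
have J1 : lv1 N \in J by rewrite inE.
have YA : Y \subset A.
  apply/subsetP => _ /imsetP[j + ->]; rewrite inE => /andP[j0 jy].
  case: (eqVneq j (y w)) => [->|ne]; first by rewrite upd_id.
  apply: (stable cS yA); first exact: level_chg.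
    by rewrite upd_neq // eq_sym.
  apply: wt_upd_lt; rewrite ltn_neqAle jy andbT.
  by apply: contra ne => /eqP h; apply/eqP/val_inj.
have xc0 : 0 < x c by rewrite xc.
(* A member of [X] other than [x] comes after [x] and shares [w] with it, so by stability it cannot
   be in [A]. *)
have dis : [disjoint A & X].
  rewrite disjoint_sym disjoint_subset; apply/subsetP => _ /imsetP[j jJ ->].
  rewrite inE; apply/negP => jA; move: jJ; rewrite inE => /andP[j0 jy].
  move/negP: xA; apply; case: (eqVneq j (lv1 N)) => [j1|j1].
    by rewrite -[x](upd_id _ c) xc -j1.
  apply: (stable wS jA) => //; first by rewrite upd_neq.
  apply: wt_upd_gt; rewrite xc /= ltn_neqAle j0 andbT.
  by apply: contra j1 => /eqP h; apply/eqP/val_inj.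
have jlt e j : e \in S -> e != c -> j \in J -> j < x e.
  move=> eS ec; rewrite inE => /andP[_ jy]; apply: leq_ltn_trans (yx eS ec).
  by apply: leq_trans jy (wmin e _); rewrite eS.
have jc j : j \in J -> j < y c.
  move=> jJ; apply: leq_trans (jlt w j wS wc jJ) _.
  have xw : 0 < x w by apply: leq_ltn_trans (yx wS wc).
  exact: pos_lt_level (top_lt ctop xw).
have XY : #|X| = #|Y| by rewrite !card_in_imset.
have Xl u : u \in X -> u \in level S k.+1.
  by case/imsetP => j; rewrite inE => /andP[j0 _] ->; apply: level_chg.
pose B := (A :\: Y) :|: X.
have Bl : B \subset level S k.+1.
  rewrite subUset (subset_trans (subsetDl _ _)) //=; apply/subsetP; exact: Xl.
have overY z : z \in A -> upd z w ord0 = upd y w ord0 -> z \in Y.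
  move=> zA zy; have zw : 0 < z w by apply: level_full kS _ wS; apply: (subsetP Al).
  have zE : z = upd y w (z w) by rewrite -(upd_upd y w ord0) -zy upd_upd upd_id.
  apply/imsetP; exists (z w) => //; rewrite inE zw leqNgt.
  by apply: contraL (ymax zA) => lt; rewrite -ltnNge zE; apply: wt_upd_gt.
(* Lowering a colour other than [c] gives a cell before [x]; hence every face of a new cell except
   [upd x c ord0] is old. *)
have lower j e : j \in J -> e \in S -> e != c -> upd (upd x c j) e (lv1 N) \in A :\: Y.
  move=> jJ eS ec; have xe : 1 < x e by apply: ltn_trans (y2 eS) (yx eS ec).
  have j0 : 0 < j by move: jJ; rewrite inE => /andP[].
  rewrite inE; apply/andP; split.
    apply/imsetP => -[i _ /ffunP/(_ c)]; rewrite upd_neq 1?eq_sym // upd_eq upd_neq 1?eq_sym // => h.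
    by have := jc j jJ; rewrite h ltnn.
  apply: xmin.
    by apply: level_chg => //; [apply: level_chg | rewrite upd_neq // ltnW].
  apply: (colex_lt (e := e)) => [|f fe]; first by rewrite upd_eq.
  rewrite upd_neq //; case: (eqVneq f c) => [->|fc]; last by rewrite upd_neq // eqxx.
  by rewrite upd_eq => _ _; apply: pos_lt; apply: jlt.
have gA : upd y w ord0 \in shadow A by apply: shadow_in.
have oldD z f : z \in A :\: Y -> 0 < z f -> upd z f ord0 \in shadow A :\ upd y w ord0.
  rewrite inE => /andP[zY zA] zf; rewrite in_setD1 shadow_in // andbT.
  apply: contra zY => /eqP h; suff fw : f = w by apply: overY => //; rewrite -{1}fw.
  apply/eqP; apply: contraT => fw.
  have fS : f \in S by apply: level_in zf; apply: (subsetP Al).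
  have := ltnW (y2 fS).
  by rewrite -(upd_neq y (e := w) ord0 fw) -h upd_eq.
have shB : shadow B \subset upd x c ord0 |: (shadow A :\ upd y w ord0).
  apply/subsetP => u /shadowP[z [f [+ zf ->]]]; rewrite in_setU => /orP[zA|].
    by rewrite in_setU oldD ?orbT.
  case/imsetP => j jJ zE; rewrite zE in zf *; have fS : f \in S.
    by apply: level_in zf; apply: Xl; apply: imset_f.
  rewrite in_setU; case: (eqVneq f c) => [->|fc].
    by rewrite upd_upd in_set1 eqxx.
  have := oldD _ f (lower j f jJ fS fc); rewrite upd_eq upd_upd => -> //.
  by rewrite orbT.
exists B; split=> //.
- by rewrite card_exchange.
- rewrite sum_exchange // (sum_setD _ YA) ltn_add2l !big_imset //=.
  rewrite (bigD1 (lv1 N)) //= [X in _ < X](bigD1 (lv1 N)) //= -addSn.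
  have lt j : j \in J -> wt (upd x c j) < wt (upd y w j).
    move=> jJ; apply: leq_trans (wt_top yc _); last by rewrite upd_neq // eq_sym.
    apply: sum_bit_lt => f _; rewrite updE; case: (eqVneq f c) => [-> _|_].
      by apply: pos_lt; apply: jc.
    exact: top_lt.
  by apply: leq_add; [apply: lt | apply: leq_sum => j /andP[/lt/ltnW]].
- apply: leq_trans (subset_leq_card shB) _.
  by rewrite (cardsD1 (upd y w ord0) (shadow A)) gA cardsU1 leq_add2r; case: (_ \notin _).
move=> _ bA; split.
  move=> z e; rewrite in_setU => /orP[zD|/imsetP[j jJ ->]] eS; rewrite in_setU.
    move: zD; rewrite !in_setD => /andP[zY zA]; rewrite (bA z e zA eS) andbT.
    apply/orP; left; apply: contra zY => /imsetP[i iJ h].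
    case: (eqVneq e w) => [ew|ew].
      apply: overY => //.
      by rewrite -(upd_upd z w (lv1 N)) -{1}ew h upd_upd.
    have := y2 eS; rewrite -(upd_neq y (e := w) i ew) -h upd_eq ltnn //.
  case: (eqVneq e c) => [->|ec]; last by rewrite lower.
  by rewrite upd_upd imset_f ?orbT.
rewrite !nonint_sum sum_exchange // (sum_setD _ YA) leq_add2l !big_imset //=.
rewrite (bigD1 (lv1 N)) //= [X in _ <= X](bigD1 (lv1 N)) //=.
(* [x] is the only new cell meeting the bottom level, and among the removed cells [upd y w (lv1 N)]
   meets it too. *)
rewrite [X in _ + X <= _]big1 => [|j /andP[jJ j1]].
  rewrite addn0 (_ : [exists e in S, upd y w (lv1 N) e == lv1 N]); last first.
    by apply/exists_inP; exists w; rewrite // upd_eq.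
  exact: leq_trans (leq_b1 _) (leq_addr _ _).
apply/eqP; rewrite eqb0; apply/exists_inP => -[e eS].
rewrite updE; case: (eqVneq e c) => [_|ec]; first by rewrite (negPf j1).
by move/eqP => xe; have := ltn_trans (y2 eS) (yx eS ec); rewrite xe.
Qed.

End Special.

Lemma exchange : exists B, improves S k.+1 B A.
Proof.
case: (posnP k) => [k0|k0].
  by exists (x |: (A :\ y)); apply: simple_exchange; left.
have [a ya] : exists e, e \in supp y.
  by apply/card_gt0P; have := yl; rewrite inE => /andP[_ /eqP ->].
rewrite in_supp in ya.
case: (@arg_maxnP _ a (fun e => 0 < y e) (fun e => pos e (y e)) ya) => c yc ctop.
case: (small_trichotomy yc ctop k0) => [x0|h|[kS xc y2 yx]].
- by exists (x |: (A :\ y)); apply: simple_exchange; right; left.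
- by exists (x |: (A :\ y)); apply: simple_exchange; right; right.
- exact: (special_exchange yc ctop).
Qed.

End Exchange.

(** * The coloured Kruskal-Katona theorem *)

Section Macaulay.

Variables M N : nat.

Local Notation pt := {ffun 'I_M -> 'I_N.+2}.

Local Notation level := (@level M N).

Implicit Types (u v x y z : pt) (c e f : 'I_M) (S : {set 'I_M}) (A B I U : {set pt}).

Lemma initialPn U A : A \subset U -> ~~ (A == seg U #|A|) ->
  exists u v, [/\ u \in A, v \in U, v \notin A & wt v < wt u].
Proof.
move=> AU neq.
case: (boolP [exists u in A, [exists v in U, (v \notin A) && (wt v < wt u)]]).
  by case/exists_inP => u uA /exists_inP[v vU /andP[vA lt]]; exists u, v.
move=> h; case/negP: neq; apply/eqP/initial_seg; split=> // u v uA vU lt.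
apply: contraNT h => vA; apply/exists_inP; exists u => //.
by apply/exists_inP; exists v => //; rewrite vA.
Qed.

(** The sections are initial, and restoring the common vertex of colour [c] keeps the order of two
    cells. *)
Lemma compress_stable S k A c u v  (E : compress S c k A = A) : c \in S -> u \in A ->
  v \in level S k.+1 -> u c = v c -> wt v < wt u -> v \in A.
Proof.
move=> cS uA vl uv lt; rewrite -[A]E inE vl.
have us : upd u c ord0 \in seg (level (S :\ c) (lev k (u c))) #|sec c (u c) A|.
  by move: uA; rewrite -{1}E inE => /andP[].
have [_ h] := seg_initial (level (S :\ c) (lev k (u c))) #|sec c (u c) A|.
rewrite -uv /=; apply: (h _ _ us).
  have /subsetP := sec_level (v c) cS (subxx (level S k.+1)); rewrite uv; apply.
  by rewrite in_sec upd_eq eqxx upd_upd upd_id.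
have := wt_upd u c ord0; have := wt_upd v c ord0; rewrite uv !bit0; lia.
Qed.

(** Induction on the number of colours, then on total weight: a family that is not a segment is
    changed by some compression or admits an exchange, and either lowers the weight without raising
    the counts. *)
Theorem macaulayT S : macaulay N S.
Proof.
have [n] := ubnP #|S|; elim: n => // n IHn in S *; rewrite ltnS => Sn.
have IH c : c \in S -> macaulay N (S :\ c).
  by move=> cS; apply: IHn; move: Sn; rewrite (cardsD1 c) cS.
case=> [|k] A.
  move=> Al; rewrite -initial_seg //; split=> // u v /(subsetP Al).
  rewrite !inE => /andP[_ /eqP/cards0_eq u0] /andP[_ /eqP/cards0_eq v0].
  suff -> : u = v by rewrite ltnn.
  apply/ffunP => e; apply/val_inj/eqP => /=.
  have := in_supp u e; have := in_supp v e; rewrite u0 v0 !inE !lt0n.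
  by move=> /esym/negbFE/eqP -> /esym/negbFE/eqP ->.
have [m] := ubnP (\sum_(u in A) wt u); elim: m => // m IHm in A *; rewrite ltnS => Am Al.
case: (boolP (A == seg (level S k.+1) #|A|)) => [/eqP <- //|ninit].
suff [B [Bl cB sB shB nB]] : exists B, improves S k.+1 B A.
  have [h1 h2] := IHm B (leq_trans sB Am) Bl.
  rewrite -cB; split; first exact: leq_trans shB.
  by move=> kS bA; have [bB le] := nB kS bA; apply: leq_trans le; apply: h2.
case: (boolP [forall c in S, compress S c k A == A]) => [/forall_inP st|]; last first.
  case/forall_inPn => c cS /eqP neq; exists (compress S c k A); split.
  - exact: fam_level.
  - exact: compress_card.
  - exact: compress_wt.
  - exact: compress_shadow (IH c cS).
  - move=> kS bA; split; first exact: compress_based.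
    exact: compress_nonint (IH c cS) kS bA.
have [u [v [uA vl vA lt]]] := initialPn Al ninit.
have vP : v \in level S k.+1 :\: A by rewrite inE vA.
case: (@arg_minnP _ v (fun z => z \in level S k.+1 :\: A) (@wt _ _) vP) => x.
rewrite inE => /andP[xA xl] xmin.
case: (@arg_maxnP _ u (fun z => z \in A) (@wt _ _) uA) => y yA ymax.
apply: (@exchange _ _ S k A Al _ x y) => //.
- by move=> c u' v' cS; apply: compress_stable => //; apply/eqP/st.
- by apply: leq_ltn_trans (xmin v vP) _; apply: leq_trans (ymax u uA).
- by move=> z zl zx; apply: contraTT zx => zA; rewrite -leqNgt xmin // inE zA.
Qed.

End Macaulay.

(** * Numerical consequences *)

Section Profile.

Variables M N : nat.

Local Notation level := (@level M N).

Implicit Types (c e : 'I_M) (S : {set 'I_M}) (j : 'I_N.+2).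

Definition shadow_size S k n : nat := #|shadow (seg (level S k) n)|.

Definition nonint_size S k n : nat := nonint S (seg (level S k) n).

Lemma seg0 U : seg U 0 = set0 :> {set {ffun 'I_M -> 'I_N.+2}}.
Proof. by apply/setP => x; rewrite !inE andbF. Qed.

Lemma shadow_size0 S k : shadow_size S k 0 = 0.
Proof.
apply/eqP; rewrite cards_eq0; apply/eqP/setP => u; rewrite in_set0.
by apply/negP => /shadowP[x [e []]]; rewrite seg0 inE.
Qed.

Lemma nonint_size0 S k : nonint_size S k 0 = 0.
Proof. by rewrite /nonint_size nonint_sum seg0 big_set0. Qed.

Lemma nonint_size_le S k n : nonint_size S k n <= n.
Proof.
apply: leq_trans (card_seg_le (level S k) n); apply: subset_leq_card.
by apply/subsetP => x; rewrite inE => /andP[].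
Qed.

Lemma sum_nth (F : nat -> nat) (s : seq nat) n : F 0 = 0 -> size s <= n ->
  \sum_(i < n) F (nth 0 s i) = \sum_(b <- s) F b.
Proof.
move=> F0; elim: s n => [|b s IH] n.
  by rewrite big_nil big1 // => i _; rewrite nth_nil.
by case: n => // n le; rewrite big_ord_recl big_cons /= IH.
Qed.

Lemma sum_nth_neq0 (F : nat -> nat) a (s : seq nat) : F 0 = 0 -> size s <= N.+1 ->
  \sum_(j : 'I_N.+2 | j != ord0) F (nth 0 (a :: s) j) = \sum_(b <- s) F b.
Proof.
move=> F0 le; rewrite big_mkcond big_ord_recl /= add0n.
by rewrite -(sum_nth F0 le).
Qed.

(** Compares the segment with a family having [a] cells without [c], [b0] at level one and the
    entries of [bs] at the levels above. This models a cone base, the cone over it and the links of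
    deleted vertices. *)
Lemma shadow_size_star S c k a b0 (bs : seq nat) : c \in S -> size bs <= N ->
  a <= #|level (S :\ c) k.+1| -> b0 <= #|level (S :\ c) k| ->
  all (fun b => b <= b0) bs -> shadow_size (S :\ c) k.+1 a <= b0 ->
  shadow_size S k.+1 (a + b0 + sumn bs) <=
    b0 + shadow_size (S :\ c) k b0 + \sum_(b <- bs) shadow_size (S :\ c) k b.
Proof.
move=> cS sz aP bP /allP bsP sh.
pose g (j : 'I_N.+2) := nth 0 (a :: b0 :: bs) j.
have gb j : j != ord0 -> g j <= b0.
  rewrite /g; case: j => -[|[|i]] //= _ _.
  by case: (ltnP i (size bs)) => [lt|ge]; [apply/bsP/mem_nth | rewrite nth_default].
have gl j : g j <= #|level (S :\ c) (lev k j)|.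
  rewrite /lev; case: eqP => [-> //|/eqP/gb le]; exact: leq_trans bP.
have gsum : \sum_j g j = a + b0 + sumn bs.
  by rewrite /g (@sum_nth id) //= !big_cons sumnE addnA.
rewrite -gsum -(fam_card cS gl).
apply: leq_trans (proj1 (macaulayT (fam_level S c k g))) _.
apply: leq_trans (card_fam_shadow cS (P := b0) sh gb) _.
rewrite -addnA leq_add2l (@sum_nth_neq0 (shadow_size (S :\ c) k)) ?big_cons //.
exact: shadow_size0.
Qed.

(** The same comparison when no cell misses [c]; the cells at level one contribute at most [b0]. *)
Lemma nonint_size_star S c k b0 (bs : seq nat) : c \in S -> k.+1 = #|S| -> size bs <= N ->
  b0 <= #|level (S :\ c) k| -> all (fun b => b <= b0) bs ->
  nonint_size S k.+1 (b0 + sumn bs) <= b0 + \sum_(b <- bs) nonint_size (S :\ c) k b.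
Proof.
move=> cS kS sz bP /allP bsP.
pose g (j : 'I_N.+2) := nth 0 (0 :: b0 :: bs) j.
have gb j : g j <= b0.
  rewrite /g; case: j => -[|[|i]] //= _.
  by case: (ltnP i (size bs)) => [lt|ge]; [apply/bsP/mem_nth | rewrite nth_default].
have gl j : g j <= #|level (S :\ c) (lev k j)|.
  rewrite /lev; case: eqP => [-> //|_]; exact: leq_trans bP.
have gsum : \sum_j g j = b0 + sumn bs.
  by rewrite /g (@sum_nth id) //= !big_cons sumnE.
rewrite -gsum -(fam_card cS gl).
apply: leq_trans (proj2 (macaulayT (fam_level S c k g)) kS _) _.
  by apply: fam_based => // j _; apply: gb.
rewrite (@nonint_sec _ _ S c) // sec_fam //; apply: leq_add.
  exact: leq_trans (card_seg_le _ _) (gb _).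
rewrite big_mkcond !big_ord_recl /= sec_fam // -[nonint _ _]/(nonint_size _ _ _) nonint_size0.
rewrite !add0n -(@sum_nth (nonint_size (S :\ c) k) bs N) ?nonint_size0 //.
apply/eq_leq/eq_bigr => i _; rewrite sec_fam //.
Qed.

Lemma card_level0 S : #|level S 0| = 1.
Proof.
pose o : {ffun 'I_M -> 'I_N.+2} := [ffun=> ord0].
suff -> : level S 0 = [set o] by rewrite cards1.
apply/setP => x; rewrite !inE.
apply/andP/eqP => [[_ /eqP/cards0_eq x0]|->].
  apply/ffunP => e; rewrite ffunE; apply/val_inj/eqP.
  by rewrite /= -leqn0 leqNgt -in_supp x0 inE.
have -> : supp o = set0.
  by apply/setP => e; rewrite !inE ffunE.
by rewrite sub0set cards0.
Qed.

(** On a fixed set of [k] colours, the cells with all vertices at the same level already number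
    [N.+1]. This leaves room for every face count bounded by [N]. *)
Lemma card_level_ge S k : 0 < k <= #|S| -> N < #|level S k|.
Proof.
case/andP => k0 kS; have [Q QS Qk] : exists2 Q : {set 'I_M}, Q \subset S & #|Q| = k.
  have [Q] : exists Q, Q \in [set Q : {set 'I_M} | Q \subset S & #|Q| == k].
    by apply/card_gt0P; rewrite cards_draws bin_gt0.
  by rewrite inE => /andP[QS /eqP]; exists Q.
pose h (i : 'I_N.+1) : {ffun 'I_M -> 'I_N.+2} := [ffun e => if e \in Q then lift ord0 i else ord0].
have /card_gt0P[q qQ] : 0 < #|Q| by rewrite Qk.
have hinj : injective h.
  by move=> i j /ffunP/(_ q); rewrite !ffunE qQ => /lift_inj.
rewrite -[X in X <= _](card_ord N.+1) -(card_imset _ hinj).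
apply: subset_leq_card; apply/subsetP => _ /imsetP[i _ ->]; rewrite inE.
suff -> : supp (h i) = Q by rewrite QS Qk eqxx.
by apply/setP => e; rewrite !inE ffunE; case: (e \in Q).
Qed.

Lemma shadow_size1 S n : shadow_size S 1 n <= 1.
Proof.
rewrite -[X in _ <= X](card_level0 S); apply: subset_leq_card.
exact: (shadow_level (seg_sub (level S 1) n)).
Qed.

End Profile.

(** * Faces of flag complexes *)

Section Flag.

Local Open Scope fset_scope.
Local Open Scope nat_scope.

Variables (T : countType) (Delta : simplicial_complex T).

Implicit Types (v w : T) (F G W U L : {fset T}) (k D : nat).

Definition faces_in W k : {fset {fset T}} :=
  [fset F in faces Delta | (F `<=` W) && (#|` F| == k)].

Definition fcount W k : nat := #|` faces_in W k|.

(** In a flag complex the link of [v] inside [W] is induced on this set, so links need no complex of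
    their own. *)
Definition nbr v W : {fset T} :=
  [fset u in W | (u != v) && ([fset v; u] \in faces Delta)].

Definition clique_bound W D : Prop :=
  forall F, F \in faces Delta -> F `<=` W -> #|` F| <= D.

Lemma in_faces_in W k F :
  (F \in faces_in W k) = [&& F \in faces Delta, F `<=` W & #|` F| == k].
Proof. by rewrite !inE. Qed.

Lemma in_nbr v W u : (u \in nbr v W) = [&& u \in W, u != v & [fset v; u] \in faces Delta].
Proof. by rewrite !inE. Qed.

Lemma nbr_sub v W : nbr v W `<=` W.
Proof. by apply/fsubsetP => u; rewrite in_nbr => /and3P[]. Qed.

Lemma nbrS v W U : W `<=` U -> nbr v W `<=` nbr v U.
Proof. by move=> WU; apply/fsubsetP => u; rewrite !in_nbr => /and3P[/(fsubsetP WU)-> -> ->]. Qed.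

Lemma notin_nbr v W : v \notin nbr v W.
Proof. by rewrite in_nbr eqxx andbF. Qed.

Lemma fcountS W U k : W `<=` U -> fcount W k <= fcount U k.
Proof.
move=> WU; apply/fsubset_leq_card/fsubsetP => F; rewrite !in_faces_in.
by case/and3P => -> FW ->; rewrite (fsubset_trans FW WU).
Qed.

Lemma face0 : fset0 \in faces Delta.
Proof.
have /fset0Pn[F FD] := faces_neq0 Delta.
exact: faces_closed (fsub0set F) FD.
Qed.

Lemma fcount0 W : fcount W 0 = 1.
Proof.
apply/eqP/cardfs1P; exists fset0; apply/fsetP => F; rewrite in_faces_in in_fset1.
apply/and3P/eqP => [[_ _]|->]; first by rewrite cardfs_eq0 => /eqP.
by rewrite face0 fsub0set cardfs0.
Qed.

Lemma fcount_gt W k D : clique_bound W D -> D < k -> fcount W k = 0.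
Proof.
move=> WD lt; apply/eqP; rewrite cardfs_eq0; apply/eqP/fsetP => F.
rewrite in_faces_in in_fset0; apply/and3P => -[FD FW /eqP Fk].
by have := WD F FD FW; rewrite Fk leqNgt lt.
Qed.

Lemma clique_boundS W U D : W `<=` U -> clique_bound U D -> clique_bound W D.
Proof. by move=> WU UD F FD FW; apply: UD => //; apply: fsubset_trans WU. Qed.

Lemma edge_face F u v : F \in faces Delta -> u \in F -> v \in F -> [fset u; v] \in faces Delta.
Proof.
by move=> FD uF vF; apply: faces_closed FD; apply/fsubsetP => w; rewrite !inE => /orP[] /eqP ->.
Qed.

Lemma face_del F v W : F \in faces Delta -> F `<=` W -> v \in F ->
  F `\ v \in faces Delta /\ F `\ v `<=` nbr v W.
Proof.
move=> FD FW vF; split; first by apply: faces_closed (fsubD1set _ _) FD.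
apply/fsubsetP => u; rewrite in_nbr !inE => /andP[uv uF].
by rewrite (fsubsetP FW) // uv (edge_face FD).
Qed.

Hypothesis hflag : flag Delta.

Definition vertices W : Prop := forall v, v \in W -> [fset v] \in faces Delta.

Lemma verticesS W U : W `<=` U -> vertices U -> vertices W.
Proof. by move=> /fsubsetP WU hU v /WU /hU. Qed.

(** Flagness enters here: [v] is adjacent to every vertex of [G], and those are pairwise
    adjacent. *)
Lemma face_add G v W : [fset v] \in faces Delta -> v \in W ->
  G \in faces Delta -> G `<=` nbr v W ->
  [/\ v |` G \in faces Delta, v |` G `<=` W & v \notin G].
Proof.
move=> vD vW GD GN; split.
- apply: hflag => [u|u w]; rewrite !in_fset1U.
    by case/orP => [/eqP -> //|uG]; have := edge_face GD uG uG; rewrite fsetUid.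
  have ev u' : u' \in G -> [fset v; u'] \in faces Delta.
    by move/(fsubsetP GN); rewrite in_nbr => /and3P[].
  case/orP => [/eqP ->|uG] /orP[/eqP ->|wG] uw; first by rewrite eqxx in uw.
  + exact: ev.
  + by rewrite fsetUC; apply: ev.
  + exact: edge_face GD uG wG.
- by rewrite fsubUset fsub1set vW (fsubset_trans GN) // nbr_sub.
- by apply: contra (notin_nbr v W); apply: (fsubsetP GN).
Qed.

Lemma fcount_split v W k : [fset v] \in faces Delta -> v \in W ->
  fcount W k.+1 = fcount (W `\ v) k.+1 + fcount (nbr v W) k.
Proof.
move=> vD vW; rewrite {1}/fcount.
have -> : faces_in W k.+1 =
    faces_in (W `\ v) k.+1 `|` [fset v |` G | G in faces_in (nbr v W) k].
  apply/fsetP => F; rewrite in_fsetU !in_faces_in; apply/and3P/orP.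
    move=> [FD FW Fk]; case: (boolP (v \in F)) => vF.
      right; apply/imfsetP; exists (F `\ v); last by rewrite fsetD1K.
      have [hD hN] := face_del FD FW vF.
      by rewrite /= in_faces_in hD hN; move: Fk; rewrite (cardfsD1 v) vF.
    by left; rewrite FD Fk fsubsetD1 FW vF.
  case=> [/and3P[-> FW ->]|/imfsetP[G /=]].
    by split=> //; apply: fsubset_trans FW (fsubD1set _ _).
  rewrite in_faces_in => /and3P[GD GN Gk] ->.
  have [-> -> vG] := face_add vD vW GD GN.
  by split=> //; rewrite cardfsU1 vG (eqP Gk).
rewrite cardfsU (_ : _ `&` _ = fset0) ?cardfs0 ?subn0; last first.
  apply/fsetP => F; rewrite in_fsetI in_fset0 in_faces_in.
  apply/negP => /andP[/and3P[_ FW _] /imfsetP[G _ FG]].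
  by have /fsubsetP/(_ v) := FW; rewrite FG !inE eqxx => /(_ isT).
congr (_ + _); rewrite card_in_imfset //= => G G'; rewrite !in_faces_in => /and3P[_ GN _] /and3P[_ GN' _] e.
have nv H : H `<=` nbr v W -> v \notin H.
  by move=> /fsubsetP HN; apply: contra (notin_nbr v W); apply: HN.
by rewrite -(fsetU1K (nv G GN)) e fsetU1K // nv.
Qed.

Lemma clique_bound_nbr v W D : [fset v] \in faces Delta -> v \in W ->
  clique_bound W D.+1 -> clique_bound (nbr v W) D.
Proof.
move=> vD vW WD F FD FN; have [h1 h2 vF] := face_add vD vW FD FN.
by have := WD _ h1 h2; rewrite cardfsU1 vF.
Qed.

(** Vertices outside the closed neighbourhood of [v0] are deleted one at a time, until only that
    neighbourhood remains. *)
Lemma peel_ind v0 W (P : {fset T} -> Prop) : v0 \in W ->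
  P (v0 |` nbr v0 W) ->
  (forall U v, U `<=` W -> v0 |` nbr v0 W `<=` U `\ v -> v \in U -> P (U `\ v) -> P U) ->
  P W.
Proof.
move=> v0W P0 PS.
suff h U : v0 |` nbr v0 W `<=` U -> U `<=` W -> P U.
  by apply: h => //; rewrite fsubUset fsub1set v0W nbr_sub.
have [n] := ubnP #|` U|; elim: n => // n IH in U *; rewrite ltnS => Un LU UW.
case: (eqVneq (v0 |` nbr v0 W) U) => [<- //|neq].
have /fsubsetPn[v vU vL] : ~~ (U `<=` v0 |` nbr v0 W).
  by apply: contra neq => UL; rewrite eqEfsubset LU.
have LU' : v0 |` nbr v0 W `<=` U `\ v by rewrite fsubsetD1 LU.
apply: (PS U v) => //; apply: IH => //; last exact: fsubset_trans (fsubD1set _ _) UW.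
by move: Un; rewrite (cardfsD1 v) vU.
Qed.

Lemma closed_nbr v0 W : v0 \in W ->
  nbr v0 (v0 |` nbr v0 W) = nbr v0 W /\ (v0 |` nbr v0 W) `\ v0 = nbr v0 W.
Proof.
move=> v0W; split; last by rewrite fsetU1K // notin_nbr.
apply/fsetP => u; rewrite !in_nbr in_fset1U in_nbr.
case: (eqVneq u v0) => [_|_]; first by rewrite !andbF.
by rewrite -andbA andbb.
Qed.

Variables (M N : nat).

Local Notation level := (@level M N).
Local Notation shadow_size := (@shadow_size M N).
Local Notation nonint_size := (@nonint_size M N).

Hypothesis hN : #|` faces Delta| <= N.

Lemma fcount_le W k : fcount W k <= N.
Proof. by apply: leq_trans hN; apply/fsubset_leq_card/fsubsetP => F; rewrite in_faces_in => /and3P[]. Qed.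

Lemma card_vertices W : vertices W -> #|` W| <= N.
Proof.
move=> hW; apply: leq_trans hN.
have inj : injective (fun v : T => [fset v]) by move=> u v /fset1_inj.
have <- : #|` [fset [fset v] | v in W]| = #|` W| by rewrite card_imfset.
apply: fsubset_leq_card.
by apply/fsubsetP => _ /imfsetP[v /= vW ->]; apply: hW.
Qed.

Lemma fcount_level W D (S : {set 'I_M}) k : clique_bound W D -> #|S| = D ->
  fcount W k <= #|level S k|.
Proof.
move=> WD SD; case: (ltnP D k) => [/(fcount_gt WD) -> //|kD].
case: k kD => [|k] kD; first by rewrite fcount0 card_level0.
by apply: leq_trans (fcount_le _ _) (ltnW (card_level_ge _ _)); rewrite SD.
Qed.

Lemma best_vertex W k : W != fset0 ->
  exists2 v, v \in W & forall u, u \in W -> fcount (nbr u W) k <= fcount (nbr v W) k.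
Proof.
case/fset0Pn => v0 v0W.
case: (@arg_maxnP _ [` v0W] predT (fun u => fcount (nbr (val u) W) k) isT) => v _ vmax.
by exists (val v) => [|u uW]; [exact: valP | exact: (vmax [` uW])].
Qed.

Lemma fcount_set0 k : fcount fset0 k.+1 = 0.
Proof. by apply: (@fcount_gt _ _ 0) => // F _; rewrite fsubset0 => /eqP ->; rewrite cardfs0. Qed.

Theorem flag_shadow D W (S : {set 'I_M}) k : vertices W -> clique_bound W D -> #|S| = D ->
  shadow_size S k.+1 (fcount W k.+1) <= fcount W k.
Proof.
elim: D => [|D IH] in W S k * => hW WD SD.
  by rewrite (fcount_gt WD) // shadow_size0.
case: k => [|k]; first by rewrite fcount0 shadow_size1.
case: (eqVneq W fset0) => [->|W0]; first by rewrite fcount_set0 shadow_size0.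
have [v0 v0W vmax] := best_vertex k.+1 W0.
have [c cS] : exists c, c \in S by apply/card_gt0P; rewrite SD.
have ScD : #|S :\ c| = D by move: SD; rewrite (cardsD1 c) cS => -[].
have IHn U v : U `<=` W -> v \in U ->
    shadow_size (S :\ c) k.+1 (fcount (nbr v U) k.+1) <= fcount (nbr v U) k.
  move=> UW vU; have vW := fsubsetP UW _ vU.
  apply: IH ScD; first by apply: verticesS hW; apply: fsubset_trans (nbr_sub _ _) UW.
  by apply: clique_bound_nbr (hW _ vW) vU _; apply: clique_boundS UW WD.
pose L := nbr v0 W.
(* [bs] lists the link sizes of the deleted vertices. The choice of [v0] keeps each entry at most
   [fcount L k.+1], and the first clause bounds the number of entries. *)
pose P U := exists bs, [/\ size bs + #|` v0 |` L| <= #|` U|,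
  fcount U k.+2 = fcount L k.+2 + fcount L k.+1 + sumn bs,
  all (fun b => b <= fcount L k.+1) bs &
  fcount L k.+1 + shadow_size (S :\ c) k.+1 (fcount L k.+1) +
    \sum_(b <- bs) shadow_size (S :\ c) k.+1 b <= fcount U k.+1].
have [bs [sz bsum bsP bsh]] : P W.
  apply: (peel_ind v0W).
    exists [::]; have [e1 e2] := closed_nbr v0W; rewrite big_nil !addn0 -/L; split=> //=.
      by rewrite (@fcount_split v0) ?hW ?fset1U1 // e1 e2.
    rewrite (@fcount_split v0 (v0 |` L) k) ?hW ?fset1U1 // e1 e2 leq_add2l.
    exact: IHn.
  move=> U v UW LU vU [bs [sz bsum bsP bsh]]; exists (fcount (nbr v U) k.+1 :: bs).
  have vW := fsubsetP UW _ vU; have vD := hW v vW; split.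
  - by rewrite (cardfsD1 v U) vU /= addSn add1n ltnS.
  - by rewrite (fcount_split _ vD vU) bsum /= -!addnA; congr (_ + (_ + _)); rewrite addnC.
  - rewrite /= bsP andbT; apply: leq_trans (vmax v vW); exact/fcountS/nbrS.
  - rewrite big_cons (fcount_split _ vD vU) addnCA addnC leq_add //.
    exact: IHn.
rewrite bsum; apply: leq_trans bsh; apply: shadow_size_star => //.
(* Fewer than [N] vertices were deleted, so there are enough levels. *)
- have := card_vertices hW; rewrite cardfsU1 notin_nbr in sz; lia.
- apply: fcount_level ScD; exact: clique_bound_nbr (hW _ v0W) v0W WD.
- apply: fcount_level ScD; exact: clique_bound_nbr (hW _ v0W) v0W WD.
- apply: IH ScD; first by apply: verticesS hW; apply: nbr_sub.
  exact: clique_bound_nbr (hW _ v0W) v0W WD.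
Qed.

End Flag.

(** * Top cycles of flag complexes *)

Section Cycles.

Local Open Scope fset_scope.
Local Open Scope nat_scope.

Variables (K : fieldType) (T : countType) (Delta : simplicial_complex T).

Implicit Types (v w : T) (F G W U L : {fset T}) (k D : nat) (z : {fset T} -> K).

Local Notation faces_in := (faces_in Delta).
Local Notation fcount := (fcount Delta).
Local Notation nbr := (nbr Delta).
Local Notation clique_bound := (clique_bound Delta).
Local Notation vertices := (vertices Delta).

(** Chains are functions on all finite sets, so that passing to links and subcomplexes needs no
    change of type. [D] is the number of vertices of a cell. *)
Definition is_cycle W D z : Prop :=
  (forall F, z F != 0%R -> F \in faces_in W D) /\
  (forall G, #|` G|.+1 = D ->
     (\sum_(v <- W | v \notin G) z (v |` G) * face_sign K (v |` G) v = 0)%R).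

Definition determines W D (B : seq {fset T}) : Prop :=
  forall z, is_cycle W D z -> (forall F, F \in B -> z F = 0%R) -> forall F, z F = 0%R.

Definition link_chain v z G : K :=
  if v \in G then 0%R else (z (v |` G) * face_sign K (v |` G) v)%R.

Lemma face_sign_neq0 F v : face_sign K F v != 0%R.
Proof. by rewrite /face_sign signr_eq0. Qed.

(** The sign cancellation behind the square of the boundary map being zero; it makes [link_chain] a
    cycle. *)
Lemma face_sign_swap G u v : u != v -> u \notin G -> v \notin G ->
  (face_sign K (v |` (u |` G)) v * face_sign K (u |` G) u =
   - (face_sign K (v |` G) v * face_sign K (v |` (u |` G)) u))%R.
Proof.
move=> uv uG vG; set F := v |` (u |` G).
have vF : v \in F by rewrite !inE eqxx.
have uF : u \in F by rewrite !inE eqxx orbT.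
have <- : F `\ v = u |` G by rewrite fsetU1K // !inE eq_sym negb_or uv.
have <- : F `\ u = v |` G.
  by rewrite /F fsetUCA fsetU1K // !inE negb_or uv.
rewrite !face_signD1 //.
have : choice.pickle u != choice.pickle v.
  by apply: contra_neq uv => /(pcan_inj choice.pickleK).
by rewrite neq_ltn => /orP[] lt; rewrite lt ltnNge (ltnW lt) /= ?mulrN ?mulNr ?opprK.
Qed.

Lemma link_cycle v W D z : v \in W -> is_cycle W D.+1 z ->
  is_cycle (nbr v W) D (link_chain v z).
Proof.
move=> vW [zs zc]; split=> [G|G GD].
  rewrite /link_chain; case: (boolP (v \in G)) => [_|vG]; first by rewrite eqxx.
  rewrite mulf_eq0 negb_or => /andP[/zs + _]; rewrite in_faces_in => /and3P[FD FW Fk].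
  have [] := face_del FD FW (fset1U1 v G); rewrite fsetU1K // in_faces_in => -> ->.
  by move: Fk; rewrite cardfsU1 vG.
case: (boolP (v \in G)) => vG.
  by rewrite big1 // => u _; rewrite /link_chain in_fset1U vG orbT mul0r.
have := zc (v |` G); rewrite cardfsU1 vG add1n GD => /(_ erefl) zc0.
have : (- face_sign K (v |` G) v *
   \sum_(u <- W | u \notin v |` G) z (u |` (v |` G)) * face_sign K (u |` (v |` G)) u = 0)%R.
  by rewrite zc0 mulr0.
rewrite big_distrr /= => h; rewrite -[RHS]h big_mkcond [RHS]big_mkcond /=.
(* Vertices of [W] not adjacent to [v] contribute nothing, as [z] is supported on faces. *)
rewrite (big_fset_incl _ (nbr_sub Delta v W)) => [|u uW uN]; last first.
  case: (boolP (u \in G)) => // uG; rewrite /link_chain in_fset1U (negPf vG) orbF.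
  case: (eqVneq v u) => [_|vu] /=; first by rewrite mul0r.
  have -> : (z (v |` (u |` G)) = 0)%R; last by rewrite !mul0r.
  apply: contraNeq uN => /zs; rewrite in_faces_in => /and3P[FD _ _].
  by rewrite in_nbr uW eq_sym vu (edge_face FD) ?inE ?eqxx ?orbT.
rewrite !big_seq; apply: eq_bigr => u uW.
rewrite /link_chain !in_fset1U (negPf vG) orbF negb_or eq_sym.
case: (eqVneq u v) => [_|uv] /=; first by case: (u \in G); rewrite ?mul0r.
case: (boolP (u \in G)) => // uG.
rewrite fsetUCA -mulrA [in RHS]mulrCA; congr (_ * _)%R.
by rewrite fsetUCA face_sign_swap // mulNr.
Qed.

(** Every top cell contains [v0], so in the boundary at [F] without [v0] only the coefficient of [F]
    survives. *)
Lemma determines_cone v0 L D : v0 \notin L -> clique_bound L D ->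
  determines (v0 |` L) D.+1 [::].
Proof.
move=> v0L LD z [zs zc] _ F; apply/eqP; apply/negPn/negP => zF.
have := zs F zF; rewrite in_faces_in => /and3P[FD FL /eqP Fk].
have inL G : G `<=` L -> #|` G| = D.+1 -> z G = 0%R.
  move=> GL Gk; apply/eqP; apply/negPn/negP => /zs; rewrite in_faces_in => /and3P[GD _ _].
  by have := LD G GD GL; rewrite Gk ltnn.
case: (boolP (v0 \in F)) => v0F; last first.
  case/negP: zF; apply/eqP/inL => //.
  have := fsubsetD1 F (v0 |` L) v0; rewrite FL v0F fsetU1K //.
set G := F `\ v0.
have v0G : v0 \notin G by rewrite !inE eqxx.
have GL : G `<=` L by rewrite -(fsetU1K v0L); apply: fsetSD.
have Gk : #|` G|.+1 = D.+1 by rewrite -Fk (cardfsD1 v0 F) v0F.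
have := zc G Gk; rewrite big_mkcond (big_fsetD1 v0) ?fset1U1 //= v0G fsetD1K //.
rewrite fsetU1K // big_seq big1 ?addr0 => [/eqP|v vL].
  by rewrite mulf_eq0 (negPf zF) (negPf (face_sign_neq0 _ _)).
case: (boolP (v \in G)) => // vG; rewrite inL ?mul0r //.
  by rewrite fsubUset fsub1set vL.
by rewrite cardfsU1 vG.
Qed.

(** Vanishing on the first list kills the link of the cycle at [v]; what remains is a cycle avoiding
    [v], which [B'] determines. *)
Lemma determines_peel v W D (B B' : seq {fset T}) : v \in W ->
  determines (nbr v W) D B -> determines (W `\ v) D.+1 B' ->
  determines W D.+1 ([seq v |` G | G <- B] ++ B').
Proof.
move=> vW dB dB' z zc zB.
have zv G : v \notin G -> z (v |` G) = 0%R.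
  move=> vG; have := dB _ (link_cycle vW zc) _ G; rewrite /link_chain (negPf vG).
  move=> h; apply/eqP; have /eqP : (z (v |` G) * face_sign K (v |` G) v)%R = 0%R.
    apply: h => H HB; case: ifP => // _; rewrite zB ?mul0r //.
    by rewrite mem_cat map_f.
  by rewrite mulf_eq0 (negPf (face_sign_neq0 _ _)) orbF.
apply: dB' => [|F FB]; last by rewrite zB // mem_cat FB orbT.
have [zs zb] := zc; split=> [F zF|G GD].
  have := zs F zF; rewrite !in_faces_in => /and3P[-> FW ->].
  rewrite fsubsetD1 FW andbT /=; apply: contra zF => vF.
  by rewrite -(fsetD1K vF) zv // !inE eqxx.
have := zb G GD; rewrite big_mkcond (big_fsetD1 v) //= -big_mkcond /=.
by case: (boolP (v \in G)) => [_|/zv ->]; rewrite ?mul0r add0r.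
Qed.

Hypothesis hflag : flag Delta.

Variables (M N : nat).

Hypothesis hN : #|` faces Delta| <= N.

Local Notation level := (@level M N).
Local Notation nonint_size := (@nonint_size M N).

Theorem flag_cycles D W (S : {set 'I_M}) : vertices W -> clique_bound W D -> #|S| = D ->
  exists2 B, determines W D B & size B + nonint_size S D (fcount W D) <= fcount W D.
Proof.
elim: D => [|D IH] in W S * => hW WD SD.
  exists [:: fset0].
    move=> z [zs _] zB F; apply/eqP; apply/negPn/negP => zF.
    have := zs F zF; rewrite in_faces_in cardfs_eq0 => /and3P[_ _ /eqP F0].
    by rewrite F0 zB ?inE ?eqxx in zF.
  rewrite fcount0 /nonint_size nonint_sum big1 ?addn0 // => x _.
  apply/eqP; rewrite eqb0; apply/exists_inP => -[e].
  by rewrite (cards0_eq SD) inE.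
case: (eqVneq W fset0) => [->|W0].
  exists [::]; last by rewrite fcount_set0 nonint_size0.
  move=> z [zs _] _ F; apply/eqP; apply/negPn/negP => /zs; rewrite in_faces_in fsubset0.
  by case/and3P => _ /eqP ->; rewrite cardfs0.
have [v0 v0W vmax] := best_vertex Delta D W0.
have [c cS] : exists c, c \in S by apply/card_gt0P; rewrite SD.
have ScD : #|S :\ c| = D by move: SD; rewrite (cardsD1 c) cS => -[].
pose L := nbr v0 W.
have LD : clique_bound L D := clique_bound_nbr hflag (hW _ v0W) v0W WD.
have vL : v0 \notin L := notin_nbr _ _ _.
(* The cone over [L] adds nothing to [B]; its [fcount L D] top cells pay for the term [b0] of
   [nonint_size_star]. *)
pose P U := exists bs B, [/\ size bs + #|` v0 |` L| <= #|` U|,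
  fcount U D.+1 = fcount L D + sumn bs,
  all (fun b => b <= fcount L D) bs,
  size B + \sum_(b <- bs) nonint_size (S :\ c) D b <= sumn bs
  & determines U D.+1 B].
have [bs [B [sz bsum bsP Bsz dB]]] : P W.
  apply: (peel_ind v0W).
    exists [::], [::]; have [e1 e2] := closed_nbr Delta v0W.
    split.
    - exact: leqnn.
    - rewrite (@fcount_split _ _ hflag v0) ?hW ?fset1U1 // e1 e2.
      by rewrite (fcount_gt LD (ltnSn D)) addnC.
    - by [].
    - by rewrite big_nil.
    - exact: determines_cone.
  move=> U v UW LU vU [bs [B [sz bsum bsP Bsz dB]]].
  have vW := fsubsetP UW _ vU; have vD := hW v vW.
  have [B1 dB1 B1sz] : exists2 B1, determines (nbr v U) D B1 &
      size B1 + nonint_size (S :\ c) D (fcount (nbr v U) D) <= fcount (nbr v U) D.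
    apply: IH ScD; first by apply: verticesS hW; apply: fsubset_trans (nbr_sub _ _ _) UW.
    by apply: clique_bound_nbr vD vU _ => //; apply: clique_boundS UW WD.
  exists (fcount (nbr v U) D :: bs), ([seq v |` G | G <- B1] ++ B); split.
  - by rewrite (cardfsD1 v U) vU /= addSn add1n ltnS.
  - by rewrite (fcount_split hflag _ vD vU) bsum /= -!addnA; congr (_ + _); rewrite addnC.
  - rewrite /= bsP andbT; apply: leq_trans (vmax v vW); exact/fcountS/nbrS.
  - by rewrite size_cat size_map big_cons addnACA leq_add.
  - exact: determines_peel.
exists B => //; rewrite bsum.
apply: (@leq_trans (size B + (fcount L D + \sum_(b <- bs) nonint_size (S :\ c) D b))).
  rewrite leq_add2l; apply: nonint_size_star => //.
    by have := card_vertices hN hW; rewrite cardfsU1 vL in sz; lia.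
  exact: (fcount_level hN _ LD ScD).
by rewrite addnCA leq_add2l.
Qed.

End Cycles.

(** * Betti numbers *)

Section Betti.

Local Open Scope fset_scope.
Local Open Scope nat_scope.

Variables (K : fieldType) (T : countType) (Delta : simplicial_complex T).

Implicit Types (v w : T) (F G W : {fset T}) (k D : nat) (z : {fset T} -> K).

Definition vertex_set : {fset T} := \bigcup_(F <- faces Delta) F.

Lemma face_sub_vertex_set F : F \in faces Delta -> F `<=` vertex_set.
Proof. by move=> FD; apply: bigfcup_sup. Qed.

Lemma vertex_set_vertices : vertices Delta vertex_set.
Proof.
move=> v /bigfcupP[F /andP[FD _] vF]; apply: faces_closed FD.
by rewrite fsub1set.
Qed.

Lemma faces_of_dimE k : faces_of_dim Delta (k%:Z - 1)%R = faces_in Delta vertex_set k.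
Proof.
apply/fsetP => F; rewrite in_faces_in !inE /=.
case: (boolP (F \in faces Delta)) => //= FD; rewrite (face_sub_vertex_set FD) /=.
by apply/eqP/eqP; lia.
Qed.

Lemma sum_faces (i : int) (f : {fset T} -> K) :
  (\sum_(a < #|{: faces_of_dim Delta i}|) f (val (enum_val a)) =
   \sum_(F <- faces_of_dim Delta i) f F)%R.
Proof.
rewrite big_seq_fsetE /= [RHS](reindex (enum_val (A := {: faces_of_dim Delta i}))) //=.
exact/onW_bij/enum_val_bij.
Qed.

Lemma boundary_coefE W F G : F `<=` W ->
  (boundary_coef K F G =
   \sum_(v <- W | v \notin G) face_sign K (v |` G) v *+ (v |` G == F))%R.
Proof.
move=> FW; rewrite /boundary_coef big_mkcond [RHS]big_mkcond /=.
rewrite -(big_fset_incl _ FW) => [|v vW vF]; last first.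
  case: ifP => // _; case: eqP => [vG|_]; last by rewrite mulr0n.
  by rewrite -vG !inE eqxx in vF.
rewrite !big_seq; apply: eq_bigr => v vF; case: eqP => [<-|neq].
  by rewrite !inE eqxx fsetD1K // eqxx mulr1n.
case: (boolP (v \in G)) => //= vG; case: eqP => [e|_]; last by rewrite mulr0n.
by case: neq; rewrite -e fsetU1K.
Qed.

(** Evaluation on [B], given by the matrix [P], is injective on cycles, so the two kernels meet
    trivially and the rank of the cycles is at most [size B]. *)
Lemma betti_le k B : determines K Delta vertex_set k B ->
  betti K Delta (k%:Z - 1)%R <= size B.
Proof.
move=> dB; set i := (k%:Z - 1)%R; rewrite /betti /cycles.
apply: leq_trans (leq_subr _ _) _.
set n := #|{: faces_of_dim Delta i}|.
pose cell (a : 'I_n) : {fset T} := val (enum_val a).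
pose P : 'M[K]_(n, size B) := (\matrix_(a, j) (cell a == nth fset0 B j)%:R)%R.
have cellP a : cell a \in faces_of_dim Delta i by apply: valP.
have cell_inj : injective cell by move=> a b /val_inj/enum_val_inj.
suff cap0 : (kermx (boundary K Delta i (i - 1)) :&: kermx P)%MS = 0%R.
  have := mxrank_sum_cap (kermx (boundary K Delta i (i - 1))) (kermx P).
  rewrite cap0 mxrank0 addn0 !mxrank_ker => e.
  have := rank_leq_row (kermx (boundary K Delta i (i - 1)) + kermx P)%MS.
  have := rank_leq_col P; have := rank_leq_row P; rewrite e.
  move: (\rank _) (\rank _) => r1 r2 h1 h2; rewrite -/n => h3; lia.
apply/eqP/rowV0P => u; rewrite sub_capmx => /andP[/sub_kermxP uM /sub_kermxP uP].
(* The row vector read as a function on all finite sets, zero off the faces of dimension [i]. *)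
pose z F : K := (\sum_a u 0%R a *+ (cell a == F))%R.
have zcell a : z (cell a) = u 0%R a.
  rewrite /z (bigD1 a) //= eqxx mulr1n big1 ?addr0 // => b ba.
  by rewrite (inj_eq cell_inj) (negPf ba) mulr0n.
suff z0 F : z F = 0%R.
  by apply/rowP => a; rewrite -zcell z0 mxE.
have zs F' : z F' != 0%R -> F' \in faces_in Delta vertex_set k.
  rewrite -faces_of_dimE -/i; apply: contraNT => F'n; rewrite /z big1 // => a _.
  by case: eqP => [e|_]; [rewrite -e cellP in F'n | rewrite mulr0n].
apply: dB => [|F' /(nthP fset0)[j jB <-]]; last first.
  have := congr1 (fun A : 'rV_(size B) => A 0%R (Ordinal jB)) uP; rewrite !mxE => h; rewrite -[RHS]h.
  by apply: eq_bigr => a _; rewrite !mxE mulr_natr.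
split=> // G Gk.
have -> : (\sum_(v <- vertex_set | v \notin G) z (v |` G) * face_sign K (v |` G) v =
           \sum_a u 0 a * boundary_coef K (cell a) G)%R.
  rewrite /z; under eq_bigr do rewrite big_distrl /=.
  rewrite exchange_big /=; apply: eq_bigr => a _.
  have aV : cell a `<=` vertex_set.
    by apply: face_sub_vertex_set; have := cellP a; rewrite !inE => /andP[].
  rewrite (boundary_coefE G aV) big_distrr /=; apply: eq_bigr => v _.
  by rewrite eq_sym; case: eqP => [->|_]; rewrite ?mulr1n ?mulr0n ?mul0r ?mulr0.
case: (boolP (G \in faces_of_dim Delta (i - 1))) => GD.
  have := congr1 (fun A : 'rV_(#|{: faces_of_dim Delta (i - 1)}|) => A 0%R (enum_rank [` GD])) uM.
  rewrite !mxE => h; rewrite -[RHS]h; apply: eq_bigr => a _.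
  by rewrite !mxE enum_rankK.
rewrite big1 // => a _; rewrite /boundary_coef big_seq_cond big1 ?mulr0 // => v /andP[va /eqP e].
case/negP: GD; rewrite !inE /=; apply/andP; split.
  rewrite -e; apply: faces_closed (fsubD1set _ _) _.
  by have := cellP a; rewrite !inE => /andP[].
by rewrite /i -Gk -addn1 PoszD addrK.
Qed.

(** Without faces of dimension [i + 1] there is nothing to divide by, and the cycles [z s] are
    independent because their values on the faces [h t] form an identity matrix. *)
Lemma betti_ge (I : finType) (i : int) (z : I -> {fset T} -> K) (h : I -> {fset T}) :
  (forall s G, G \in faces_of_dim Delta (i - 1)%R ->
     (\sum_(F <- faces_of_dim Delta i) z s F * boundary_coef K F G = 0)%R) ->
  (forall s, h s \in faces_of_dim Delta i) ->
  (forall s t, z s (h t) = (s == t)%:R%R) ->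
  faces_of_dim Delta (i + 1)%R = fset0 -> #|I| <= betti K Delta i.
Proof.
move=> zc hi zh top; rewrite /betti.
have -> : \rank (boundaries K Delta i) = 0.
  apply/eqP; rewrite -leqn0; apply: leq_trans (rank_leq_row _) _.
  by rewrite top -cardfE cardfs0.
rewrite subn0 /cycles.
pose C : 'M[K]_(#|I|, #|{: faces_of_dim Delta i}|) :=
  (\matrix_(a, b) z (enum_val a) (val (enum_val b)))%R.
pose P : 'M[K]_(#|{: faces_of_dim Delta i}|, #|I|) :=
  (\matrix_(b, a) (val (enum_val b) == h (enum_val a))%:R)%R.
have CP : (C *m P = 1%:M)%R.
  apply/matrixP => a b; rewrite !mxE.
  under eq_bigr do rewrite !mxE.
  rewrite (sum_faces i (fun F => z (enum_val a) F * (F == h (enum_val b))%:R)%R).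
  rewrite (big_fsetD1 _ (hi (enum_val b))) /= eqxx mulr1 zh (inj_eq enum_val_inj).
  rewrite big_seq big1 ?addr0 // => F; rewrite !inE => /andP[/negPf -> _].
  by rewrite mulr0.
have rC : \rank C = #|I|.
  by apply/eqP; rewrite eqn_leq rank_leq_row -{1}(mxrank1 K #|I|) -CP mxrankM_maxl.
rewrite -rC; apply: mxrankS; apply/sub_kermxP/matrixP => a b; rewrite !mxE.
under eq_bigr do rewrite !mxE.
rewrite (sum_faces i (fun F => z (enum_val a) F * boundary_coef K F (val (enum_val b)))%R).
by apply: zc; apply: valP.
Qed.

End Betti.

(** * The balanced complex *)

(* Pickling a vertex (colour, level) colour-major makes the position of a vertex
   in a face with all colours equal to its colour. *)
Definition vert (M N : nat) := ('I_M * 'I_N.+2)%type.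

HB.instance Definition _ M N := Choice.copy (vert M N) ('I_M * 'I_N.+2)%type.

Definition vert_code M N (v : vert M N) : nat := v.1 * N.+2 + v.2.

Definition vert_decode M N (n : nat) : option (vert M N) :=
  [pick v : 'I_M * 'I_N.+2 | vert_code v == n].

Lemma vert_codeK M N : pcancel (@vert_code M N) (@vert_decode M N).
Proof.
move=> v; rewrite /vert_decode; case: pickP => [w /eqP|/(_ v)]; last by rewrite eqxx.
have div (u : vert M N) : vert_code u %/ N.+2 = u.1 :> nat.
  by rewrite /vert_code divnMDl // divn_small ?addn0.
have mod (u : vert M N) : vert_code u %% N.+2 = u.2 :> nat by rewrite /vert_code modnMDl modn_small.
move=> wv; congr Some; rewrite [w]surjective_pairing [v]surjective_pairing.
by congr pair; apply: val_inj; rewrite /= -?div -?mod wv.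
Qed.

HB.instance Definition _ M N := isCountable.Build (vert M N) (@vert_codeK M N).

Lemma vert_pickle M N (v : vert M N) : choice.pickle v = vert_code v.
Proof. by []. Qed.

Section Model.

Local Open Scope fset_scope.
Local Open Scope nat_scope.

Variables (M N : nat) (f : nat -> nat).

Local Notation pt := {ffun 'I_M -> 'I_N.+2}.
Local Notation level := (@level M N).
Local Notation full k := (level [set: 'I_M] k).

Implicit Types (x y g : pt) (e : 'I_M) (v : vert M N) (F G : {fset vert M N}).

Definition enc x : {fset vert M N} := [fset ((e, x e) : vert M N) | e in supp x].

Lemma in_enc x v : (v \in enc x) = (x v.1 == v.2) && (0 < v.2).
Proof.
apply/imfsetP/andP => /= [[e + ->]|[/eqP xv v0]]; first by rewrite in_supp /= eqxx.
by exists v.1; rewrite ?in_supp xv //; case: v xv v0.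
Qed.

Lemma enc_inj : injective enc.
Proof.
move=> x y xy; apply/ffunP => e.
have h z z' : enc z = enc z' -> 0 < z e -> z' e = z e.
  by move=> zz ze; have := in_enc z (e, z e); rewrite zz in_enc /= eqxx ze !andbT => /eqP.
case: (posnP (x e)) => [x0|/(h _ _ xy) //]; case: (posnP (y e)) => [y0|/(h _ _ (esym xy)) //].
by apply: val_inj; rewrite /= x0.
Qed.

Lemma card_enc x : #|` enc x| = #|supp x|.
Proof. by rewrite card_imfset /= -?cardE // => e e' []. Qed.

Lemma enc_upd0 x e : enc (upd x e ord0) = enc x `\ ((e, x e) : vert M N).
Proof.
apply/fsetP => -[a j]; rewrite !inE !in_enc /= updE xpair_eqE.
case: (eqVneq a e) => [->|_] //=.
rewrite [x e == _]eq_sym (_ : (ord0 == j) && _ = false); last by case: eqP => // <-.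
by case: (j == x e).
Qed.

Definition restr x (Q : {set 'I_M}) : pt := [ffun e => if e \in Q then x e else ord0].

(** Colours outside [Q] are removed one at a time, so closure under single removals suffices. *)
Lemma restr_ind (P : pt -> Prop) x Q :
  (forall y e, P y -> 0 < y e -> P (upd y e ord0)) -> P x -> P (restr x Q).
Proof.
move=> PS; have [n] := ubnP #|supp x :\: Q|; elim: n => // n IH in x *; rewrite ltnS => xn Px.
case: (set_0Vmem (supp x :\: Q)) => [/eqP|[e]].
  rewrite setD_eq0 => /subsetP sub; suff -> : restr x Q = x by [].
  apply/ffunP => e; rewrite ffunE; case: ifP => // eQ.
  apply/esym/val_inj/eqP; rewrite /= -leqn0 leqNgt -in_supp.
  by apply/negP => /sub; rewrite eQ.
rewrite !inE => /andP[eQ xe].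
have -> : restr x Q = restr (upd x e ord0) Q.
  apply/ffunP => a; rewrite !ffunE; case: ifP => // aQ; case: eqP => // ae.
  by rewrite ae (negPf eQ) in aQ.
apply: IH; last exact: PS.
apply: leq_trans xn; apply: proper_card; apply/properP; split.
  by rewrite supp_upd0; apply: setSD; apply: subD1set.
by exists e; rewrite !inE ?eQ ?upd_eq.
Qed.

Hypothesis f0 : f 0 = 1.
Hypothesis f_level : forall k, f k <= #|full k|.
Hypothesis f_shadow : forall k, shadow_size N [set: 'I_M] k.+1 (f k.+1) <= f k.

Definition cells : {set pt} := [set x | x \in seg (full #|supp x|) (f #|supp x|)].

Lemma in_cells x k : #|supp x| = k -> (x \in cells) = (x \in seg (full k) (f k)).
Proof. by move=> <-; rewrite inE. Qed.

Lemma card_supp_seg x k : x \in seg (full k) (f k) -> #|supp x| = k.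
Proof. by move/(subsetP (seg_sub _ _)); rewrite inE => /andP[_ /eqP]. Qed.

(** The shadow of one segment and the next smaller segment are both initial, so the size bound
    [f_shadow] gives inclusion. *)
Lemma cells_upd0 x e : x \in cells -> 0 < x e -> upd x e ord0 \in cells.
Proof.
move=> xG xe; have [k sk] : exists k, #|supp x| = k.+1.
  by exists #|supp x|.-1; rewrite prednK //; apply/card_gt0P; exists e; rewrite in_supp.
rewrite (in_cells sk) in xG.
rewrite (@in_cells _ k); last first.
  by rewrite supp_upd0; move: sk; rewrite (cardsD1 e) in_supp xe => -[].
apply: (subsetP (initial_sub_seg _ (f_shadow k))).
  by apply: shadow_initial; apply: seg_initial.
exact: shadow_in.
Qed.

Definition model_faces : {fset {fset vert M N}} := [fset enc x | x in cells].

Lemma in_model_faces F : reflect (exists2 x, x \in cells & F = enc x) (F \in model_faces).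
Proof. by apply: (iffP (imfsetP _ _ _ _)) => /= -[x xc ->]; exists x. Qed.

Lemma enc_model_faces x : (enc x \in model_faces) = (x \in cells).
Proof.
by apply/in_model_faces/idP => [[y yc /enc_inj ->]//|xc]; exists x.
Qed.

Lemma model_neq0 : model_faces != fset0.
Proof.
have /card_gt0P[x xs] : 0 < #|seg (full 0) (f 0)| by rewrite card_seg // f0.
apply/fset0Pn; exists (enc x); rewrite enc_model_faces (@in_cells _ 0) //.
exact: card_supp_seg xs.
Qed.

Lemma model_closed F G : G `<=` F -> F \in model_faces -> G \in model_faces.
Proof.
move=> GF /in_model_faces[x xc Fx]; rewrite {F}Fx in GF.
pose Q := [set e | ((e, x e) : vert M N) \in G].
have -> : G = enc (restr x Q).
  apply/fsetP => -[a j]; rewrite in_enc /= ffunE inE.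
  apply/idP/andP => [aG|].
    have := fsubsetP GF _ aG; rewrite in_enc /= => /andP[/eqP xa j0].
    by rewrite xa aG eqxx.
  by case: ifP => [aG [/eqP <-]|_ [/eqP <-]].
rewrite enc_model_faces; by apply: (@restr_ind (fun y => y \in cells)) => // y e; apply: cells_upd0.
Qed.

Definition model : simplicial_complex (vert M N) :=
  @SimplicialComplex (vert M N) model_faces model_neq0 model_closed.

Lemma faces_of_dim_model k :
  faces_of_dim model (k%:Z - 1)%R = [fset enc x | x in seg (full k) (f k)].
Proof.
apply/fsetP => F; rewrite !inE /=; apply/andP/imfsetP => /=.
  case=> /in_model_faces[x xc ->] /eqP; rewrite card_enc => h.
  have xk : #|supp x| = k by lia.
  by exists x => //; rewrite -(in_cells xk).
move=> [x xs ->]; have xk := card_supp_seg xs.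
by rewrite enc_model_faces (in_cells xk) card_enc xk.
Qed.

Lemma fnum_model k : fnum model (k%:Z - 1)%R = f k.
Proof.
rewrite /fnum faces_of_dim_model card_imfset /=; last exact: enc_inj.
by rewrite -cardE card_seg.
Qed.

Lemma card_enc_le x : #|` enc x| <= M.
Proof. by rewrite card_enc -[X in _ <= X]card_ord max_card. Qed.

(** * Top cycles from cross-polytopes *)

Section CrossPolytopes.

Variable K : fieldType.

Local Notation top := (seg (full M) (f M)).

Definition below x y : bool := [forall e, (y e == x e) || (y e == lv1 N)].

(* Coefficient of the facet y in the cross-polytope spanned by x and the lowest vertices. *)
Definition cross x y : K :=
  if below x y then ((-1) ^+ #|[set e | y e != x e]|)%R else 0%R.

(** Replacing vertices by the lowest ones never raises the weight, so the whole cross-polytope lies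
    in the segment. *)
Lemma below_top x y : x \in top -> below x y -> y \in top.
Proof.
move=> xt /forallP xy; have [tl ht] := seg_initial (full M) (f M).
have xl := subsetP tl _ xt.
have xe e : 0 < x e by apply: level_full xl _; rewrite ?cardsT ?card_ord ?inE.
have ye e : 0 < y e by case/orP: (xy e) => /eqP ->.
have yl : y \in full M.
  rewrite inE subsetT /=; have -> : supp y = [set: 'I_M].
    by apply/setP => e; rewrite !inE ye.
  by rewrite cardsT card_ord.
have : wt y <= wt x.
  apply: leq_sum => e _; case/orP: (xy e) => /eqP -> //; case: (eqVneq (x e) (lv1 N)) => [-> //|ne].
  apply/ltnW/ltn_bit_level; rewrite /= ltn_neqAle xe andbT.
  by apply: contra ne => /eqP h; apply/eqP/val_inj.
by rewrite leq_eqVlt => /orP[/eqP/wt_inj -> //|]; apply: ht.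
Qed.

Lemma cross_upd x y e (j : 'I_N.+2) :
  cross x (upd y e j) =
  (if [forall a, (a != e) ==> ((y a == x a) || (y a == lv1 N))] &&
      ((j == x e) || (j == lv1 N))
   then (-1) ^+ ((j != x e) + #|[set a | (a != e) && (y a != x a)]|) else 0)%R.
Proof.
have -> : [forall a, (a != e) ==> ((y a == x a) || (y a == lv1 N))] &&
      ((j == x e) || (j == lv1 N)) = below x (upd y e j).
  apply/andP/forallP => [[/forallP h1 h2] a|h].
    by rewrite updE; case: (eqVneq a e) => [-> //|ae]; apply: (implyP (h1 a)).
  split; last by have := h e; rewrite upd_eq.
  by apply/forallP => a; apply/implyP => ae; have := h a; rewrite upd_neq.
rewrite /cross (cardsD1 e) inE upd_eq; case: below => //; congr (_ ^+ (_ + _))%R.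
apply: eq_card => a; rewrite !inE updE.
by case: (eqVneq a e).
Qed.

(** Over [g] there are either two facets of the cross-polytope, with opposite signs, or none. *)
Lemma sum_cross x g e : g e = ord0 -> 1 < x e ->
  (\sum_(y | upd y e ord0 == g) cross x y = 0)%R.
Proof.
move=> ge xe; rewrite (reindex_onto (upd g e) (fun y => y e)) /=; last first.
  by move=> y /eqP <-; rewrite upd_upd upd_id.
rewrite (eq_bigl predT); last by move=> j; rewrite upd_upd (upd_same ge) upd_eq !eqxx.
have x1 : x e != lv1 N by apply: contraTneq xe => ->.
rewrite (bigD1 (x e)) //= (bigD1 (lv1 N)) 1?eq_sym //= big1 ?addr0 => [|j /andP[/negPf j1 /negPf j2]].
  rewrite !cross_upd !eqxx orbT /= [lv1 N == _]eq_sym x1 add0n add1n.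
  by case: ifP => // _; rewrite ?addr0 // exprS mulN1r subrr.
by rewrite cross_upd j1 j2 andbF.
Qed.

Lemma card_lt_ord e : #|[set a : 'I_M | a < e]| = e.
Proof.
rewrite -sum1_card (eq_bigl (fun a : 'I_M => a < e)) => [|a]; last by rewrite inE.
by rewrite -(big_ord_widen M (fun=> 1)) ?sum1_card ?card_ord // ltnW.
Qed.

(** As [y] has all colours, exactly the [e] smaller colours precede its vertex of colour [e]. *)
Lemma face_sign_enc y e : y \in full M -> face_sign K (enc y) ((e, y e) : vert M N) = ((-1) ^+ e)%R.
Proof.
move=> yl; rewrite /face_sign; congr (_ ^+ _)%R.
have ye a : 0 < y a by apply: level_full yl _; rewrite ?cardsT ?card_ord ?inE.
rewrite -[RHS]card_lt_ord.
have -> : [fset w in enc y | choice.pickle w < choice.pickle ((e, y e) : vert M N)] =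
    [fset ((a, y a) : vert M N) | a in [set a : 'I_M | a < e]].
  apply/fsetP => -[a j]; rewrite !inE in_enc /= !vert_pickle /vert_code /=.
  have lt i (b c : 'I_M) : b < c -> b * N.+2 + y b < c * N.+2 + i.
    by move=> bc; have := ltn_ord (y b); nia.
  apply/idP/imfsetP => /= [/andP[/andP[/eqP <- _] h]|[b + [-> ->]]].
    exists a => //; rewrite ?inE /= ltnNge leq_eqVlt; apply/negP => /orP[/eqP/val_inj ea|/lt].
      by rewrite ea ltnn in h.
    by move/(_ (y a)); rewrite ltnNge ltnW.
  by rewrite ?inE /= eqxx ye => /lt ->.
by rewrite card_imfset /= -?cardE // => a b [].
Qed.

Lemma boundary_coef_enc y g e : y \in full M -> g e = ord0 ->
  (forall a, a != e -> 0 < g a) ->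
  boundary_coef K (enc y) (enc g) = ((-1) ^+ e *+ (upd y e ord0 == g))%R.
Proof.
move=> yl ge gpos.
have ye a : 0 < y a by apply: level_full yl _; rewrite ?cardsT ?card_ord ?inE.
rewrite /boundary_coef big_mkcond (big_fsetD1 ((e, y e) : vert M N)) /=; last first.
  by rewrite in_enc eqxx ye.
rewrite -enc_upd0 (inj_eq enc_inj) face_sign_enc // big_seq big1 ?addr0.
  by case: (_ == g).
move=> -[a j]; rewrite in_enc /= updE.
case: (eqVneq a e) => [_ /andP[/eqP <-] //|ae /andP[/eqP <- _]].
rewrite -enc_upd0 (inj_eq enc_inj); case: eqP => // yg.
by have := gpos a ae; rewrite -yg upd_eq.
Qed.

(** The cells of the top segment avoiding level one index the cycles. Such a cell is a facet of no
    other of these cross-polytopes, which gives the identity matrix required by [betti_ge]. *)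
Theorem betti_model :
  f M - nonint_size N [set: 'I_M] M (f M) <= betti K model (M%:Z - 1)%R.
Proof.
pose NI := [set x in top | [exists e in [set: 'I_M], x e == lv1 N]].
pose Int := top :\: NI.
have IntT x : x \in Int -> x \in top by rewrite in_setD => /andP[].
have IntP x : x \in Int -> forall e, 1 < x e.
  rewrite in_setD => /andP[xN xt] e; have xl := subsetP (seg_sub _ _) _ xt.
  have xe : 0 < x e by apply: level_full xl _; rewrite ?cardsT ?card_ord ?inE.
  rewrite ltn_neqAle xe andbT eq_sym; apply: contra xN => /eqP xe1.
  rewrite in_set xt; apply/exists_inP; exists e; rewrite ?inE //.
  exact/eqP/val_inj.
have -> : f M - nonint_size N [set: 'I_M] M (f M) = #|{: {x | x \in Int}}|.
  rewrite card_sig -{1}(card_seg (f_level M)).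
  have -> : #|[pred x in Int]| = #|Int| by apply: eq_card.
  by rewrite cardsD (setIidPr _) //; apply/subsetP => x; rewrite in_set => /andP[].
have dimE : faces_of_dim model (M%:Z - 1)%R = [fset enc y | y in top] := faces_of_dim_model M.
have sum_top (h : {fset vert M N} -> K) :
    (\sum_(F <- faces_of_dim model (M%:Z - 1)) h F = \sum_(y in top) h (enc y))%R.
  by rewrite dimE big_imfset /=; [rewrite big_enum | move=> x y _ _ /enc_inj].
pose z (s : {x | x \in Int}) F : K := (\sum_(y in top) cross (val s) y *+ (enc y == F))%R.
have zE s y : y \in top -> z s (enc y) = cross (val s) y.
  move=> yt; rewrite /z (bigD1 y) //= eqxx mulr1n big1 ?addr0 // => x /andP[_ xy].
  by rewrite (inj_eq enc_inj) (negPf xy) mulr0n.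
apply: (@betti_ge _ _ _ _ _ z (fun s => enc (val s))).
(* For [M = 0] the target dimension is [-2], where there are no faces. *)
- move=> s G; case: (posnP M) => [M0|M0].
    by rewrite !inE => /andP[_ /eqP h]; exfalso; move: h M0; clear; lia.
  have -> : (M%:Z - 1 - 1 = M.-1%:Z - 1)%R by lia.
  rewrite faces_of_dim_model => /imfsetP[/= g gt ->].
  have gl := subsetP (seg_sub _ _) _ gt.
  have gM : M.-1 < #|[set: 'I_M]| by rewrite cardsT card_ord prednK.
  (* [e] is the only colour missing from [g], so the boundary at [g] is a sum over the levels of [e]
     with constant sign. *)
  have [e _ ge] := level_absent gl gM.
  have gpos a : a != e -> 0 < g a.
    move=> ae; rewrite -in_supp; apply: contraT => ag.
    have : supp g \subset [set: 'I_M] :\ e :\ a.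
      apply/subsetP => b; rewrite !inE andbT => gb; apply/andP; split.
        by apply: contraNneq ag => <-; rewrite in_supp.
      by apply: contraTneq gb => ->; rewrite ge.
    move/subset_leq_card; rewrite (card_supp_seg gt).
    have := cardsD1 e [set: 'I_M]; have := cardsD1 a ([set: 'I_M] :\ e).
    rewrite cardsT card_ord !inE ae /=; lia.
  rewrite sum_top.
  have xt := IntT _ (valP s).
  transitivity (\sum_(y | upd y e ord0 == g) cross (val s) y * (-1) ^+ e)%R; last first.
    by rewrite -big_distrl /= sum_cross ?mul0r //; apply: IntP (valP s) _.
  rewrite big_mkcond [RHS]big_mkcond /=; apply: eq_bigr => y _.
  case: (boolP (y \in top)) => yt.
    rewrite zE // (boundary_coef_enc _ ge gpos) ?(subsetP (seg_sub _ _) _ yt) //.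
    by case: (_ == g); rewrite ?mulr1n ?mulr0n ?mulr0.
  rewrite /cross (_ : below _ _ = false) ?mul0r ?if_same //.
  by apply: contraNF yt; apply: below_top xt.
- move=> s; rewrite dimE; apply: in_imfset => /=.
  exact: IntT (valP s).
- move=> s t; rewrite zE; last exact: IntT (valP t).
  case: eqP => [<-|st].
    have c0 : [set e | val s e != val s e] = set0 by apply/setP => e; rewrite !inE eqxx.
    by rewrite /cross c0 cards0 ifT //; apply/forallP => e; rewrite eqxx.
  rewrite /cross ifN //; apply: contra_notN st => /forallP h; apply/val_inj/ffunP => e.
  by case/orP: (h e) => /eqP // h1; have := IntP _ (valP t) e; rewrite h1.
- have -> : (M%:Z - 1 + 1 = M.+1%:Z - 1)%R by lia.
  rewrite faces_of_dim_model; apply/fsetP => F; rewrite in_fset0.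
  apply/imfsetP => -[/= x xs _]; have := card_enc_le x.
  by rewrite card_enc (card_supp_seg xs) ltnn.
Qed.

End CrossPolytopes.

Hypothesis fM : 0 < f M.

Lemma complex_dim_model : complex_dim model = (M%:Z - 1)%R.
Proof.
rewrite /complex_dim; suff -> : \max_(F <- faces model) #|` F| = M by [].
apply/eqP; rewrite eqn_leq; apply/andP; split.
  by apply/bigmax_leqP_seq => F /in_model_faces[x _ ->] _; apply: card_enc_le.
have /card_gt0P[x xs] : 0 < #|seg (full M) (f M)| by rewrite card_seg.
have xM := card_supp_seg xs.
apply: (@leq_trans #|` enc x|); first by rewrite card_enc xM.
have xD : enc x \in enum_fset (faces model) by rewrite enc_model_faces (in_cells xM).
exact: (leq_bigmax_seq (F := fun F : {fset vert M N} => #|` F|) _ xD).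
Qed.

Lemma model_balanced : balanced model.
Proof.
exists M; split; first exact: complex_dim_model.
exists (fun (i : 'I_M) (v : vert M N) => v.1 == i); split=> [v|F].
  by exists v.1; split=> [|i]; rewrite unfold_in ?eqxx // => /eqP.
move=> /in_model_faces[x _ ->] i; rewrite -(cardfs1 ((i, x i) : vert M N)).
apply/fsubset_leq_card/fsubsetP => -[a j]; rewrite !inE in_enc /=.
by move=> /andP[/andP[/eqP <- _] /eqP /= ->].
Qed.

End Model.

Theorem theorem1p1 (K : fieldType) (T : countType) (Delta : simplicial_complex T)
    (d : int) (hdim : complex_dim Delta = d) (hflag : flag Delta) :
  exists (T' : countType) (Gamma : simplicial_complex T'),
    [/\ balanced Gamma,
        fvector Gamma = fvector Delta &
        (betti K Delta d <= betti K Gamma d)%N].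
Proof.
(* [M], equal to [d + 1], is the number of colours, and [N] bounds both the face counts and the
   number of vertices. *)
pose M := \max_(F <- faces Delta) #|` F|%fset; pose N := #|` faces Delta|%fset.
pose W := vertex_set Delta; pose f := fcount Delta W.
have hW : vertices Delta W := @vertex_set_vertices T Delta.
have WM : clique_bound Delta W M by move=> F FD _; apply: (leq_bigmax_seq (F := fun F : {fset T} => #|` F|%fset)).
have SM : #|[set: 'I_M]| = M by rewrite cardsT card_ord.
have f0 : f 0 = 1 := fcount0 Delta W.
have f_level k : f k <= #|level (N := N) [set: 'I_M] k| := fcount_level (leqnn N) k WM SM.
have f_shadow k : shadow_size N [set: 'I_M] k.+1 (f k.+1) <= f k :=
  flag_shadow hflag (leqnn N) k hW WM SM.
have fM : 0 < f M.
  have [F FD FM] : exists2 F, F \in faces Delta & #|` F|%fset = M.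
    have nonempty : 0 < #|{: faces Delta}| by rewrite -cardfE cardfs_gt0 faces_neq0.
    have [F FM] := eq_bigmax (fun F : faces Delta => #|` val F|%fset) nonempty.
    by exists (val F); [apply: valP | rewrite -FM /M big_seq_fsetE].
  rewrite cardfs_gt0; apply/fset0Pn; exists F; rewrite in_faces_in FD FM eqxx andbT.
  exact: face_sub_vertex_set.
have dE : d = (M%:Z - 1)%R by rewrite -hdim.
have dimE := complex_dim_model f0 f_level f_shadow fM.
exists (vert M N), (model f0 f_level f_shadow); split.
- exact: model_balanced.
- rewrite /fvector dimE hdim dE; apply: eq_map => k.
  by rewrite fnum_model /fnum faces_of_dimE.
(* Both Betti numbers are compared with the number of cells of the top segment that avoid the bottom
   level. *)
rewrite dE; apply: leq_trans _ (betti_model f0 f_level f_shadow K).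
have [B dB Bsz] := flag_cycles K hflag (leqnn N) hW WM SM.
apply: leq_trans (betti_le dB) _; rewrite leq_subRL ?nonint_size_le //.
by rewrite addnC.
Qed.
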